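(* Let $p$ be a prime and let $l\ge 1$ be an integer. Then there exists a finite solvable group $G$ of $p$-length $l_p(G)\ge l$ such that $G$ has a non-nilpotent $p$-block $B$ of maximal defect with $l(B)=1$.
   Context: For a $p$-block $B$ of a finite group $G$, $\mathrm{IBr}(B)$ is the set of irreducible $p$-Brauer characters belonging to $B$ and $l(B):=|\mathrm{IBr}(B)|$. $B$ has maximal defect if its defect groups are Sylow $p$-subgroups of $G$. A $B$-subpair is a pair $(Q,b_Q)$ where $Q$ is a $p$-subgroup of $G$ and $b_Q$ is a Brauer correspondent of $B$ in $\mathrm{C}_G(Q)$. The block $B$ is nilpotent (in the sense of Broué--Puig) if for every $B$-subpair $(Q,b_Q)$ the group $\mathrm{N}_G(Q,b_Q)/\mathrm{C}_G(Q)$ is a $p$-group, where $\mathrm{N}_G(Q,b_Q)$ is the stabilizer of $b_Q$ in $\mathrm{N}_G(Q)$. The $p$-length $l_p(G)$ of a $p$-solvable group $G$ is the number of factors which are nontrivial $p$-groups in the series $1\le \mathrm{O}_{p'}(G)\le \mathrm{O}_{p'p}(G)\le \mathrm{O}_{p'pp'}(G)\le\cdots\le G$. *)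

(* Defs.v *)
From HB Require Import structures.
From mathcomp Require Import all_boot all_order all_algebra all_fingroup.
From mathcomp Require Import all_solvable all_field all_character.
From mathcomp Require Import finmap boolp classical_sets cardinality.

Set Implicit Arguments.
Unset Strict Implicit.
Unset Printing Implicit Defensive.

Import Order.TTheory GRing.Theory Num.Theory GroupScope.
Local Open Scope ring_scope.

(* The k-th term, k >= 0, of the series 1 <= O_p'(G) <= O_p'p(G) <= ... *)
Definition upper_p_series (p k : nat) (gT : finGroupType) (G : {group gT}) :
    {group gT} :=
  [group of pseries
    (mkseq (fun i => if odd i then (p : nat_pred) else (p : nat_pred)^') k) G].

(* From its second term on, the series is strictly increasing until it becomes
   stationary, so all its nontrivial factors have an index below #|G|. *)
Definition p_length (p : nat) (gT : finGroupType) (G : {group gT}) : nat :=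
  let factor i := (upper_p_series p i.+1 G / upper_p_series p i G)%g in
  #|[set i : 'I_#|G| | (factor i != 1%g) && p.-group (factor i)]|.

(* A p-modular setting: reduction R -> F, where R is the ring of algebraic
   integers in algC and F is algebraically closed of characteristic p. The
   kernel on R is then a maximal ideal containing p; values of [red] outside R
   are irrelevant. *)
Record p_modular (p : nat) (F : closedFieldType) := PModular {
  red :> algC -> F;
  pchar_red : p \in [pchar F];
  red1 : red 1 = 1;
  redD : {in Aint &, {morph red : x y / x + y}};
  redM : {in Aint &, {morph red : x y / x * y}} }.

Section GroupAlgebra.

Variable F : closedFieldType.
Variable gT : finGroupType.
Implicit Types G H Q D : {group gT}.

(* The group algebra FG is [group_ring F G], its elements being represented by
   matrices of size #|G| through the regular representation. *)
Notation FG G := 'M[F]_#|pred_of_set (gval G)|.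
Notation ZFG G := 'Z(group_ring F G)%MS.

(* The coefficient of x \in G in z \in FG. *)
Definition gcoef G (z : FG G) (x : gT) : F := gring_row z 0 (gring_index G x).

(* The F-linear projection FG -> FH discarding the elements outside H. *)
Definition gtrunc G H (z : FG G) : FG H :=
  \sum_(x in H) gcoef z x *: regular_repr F H x.

(* Conjugation by x on FG, for x normalizing G. *)
Definition gconj G (x : gT) (z : FG G) : FG G :=
  \sum_(y in G) gcoef z y *: regular_repr F G (y ^ x)%g.

(* A block is represented by its block idempotent, i.e. a primitive idempotent
   of Z(FG). *)
Definition block G (e : FG G) : Prop :=
  [/\ (e \in ZFG G)%MS, e *m e = e, e != 0 &
      forall f : FG G, (f \in ZFG G)%MS -> f *m f = f -> e *m f = f ->
        f = 0 \/ f = e].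

(* lam restricts to the central character Z(FG) -> F of the block e; it is
   unital because lam 1 = lam 1 * lam e = lam e. *)
Definition central_character G (e : FG G) (lam : FG G -> F) : Prop :=
  [/\ forall (a : F) (y z : FG G), (y \in ZFG G)%MS -> (z \in ZFG G)%MS ->
        lam (a *: y + z) = a * lam y + lam z,
      forall y z : FG G, (y \in ZFG G)%MS -> (z \in ZFG G)%MS ->
        lam (y *m z) = lam y * lam z
    & lam e = 1].

(* b^G = B, in the sense of Brauer. *)
Definition brauer_correspondent G H (B : FG G) (b : FG H) : Prop :=
  exists lamB lamb, [/\ central_character B lamB, central_character b lamb &
    forall z : FG G, (z \in ZFG G)%MS -> lamB z = lamb (gtrunc H z)].

(* The Brauer homomorphism Z(FG) -> Z(F C_G(D)) is the truncation to C_G(D). *)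
Definition defect_group (p : nat) G (B : FG G) D : bool :=
  [max D | p.-subgroup(G) D & gtrunc 'C_G(D) B != 0].

Definition maximal_defect (p : nat) G (B : FG G) : Prop :=
  forall D, defect_group p B D -> p.-Sylow(G) D.

Definition subpair (p : nat) G (B : FG G) Q (b : FG 'C_G(Q)%G) : Prop :=
  [/\ p.-subgroup(G) Q, block b & brauer_correspondent B b].

Definition subpair_stab G Q (b : FG 'C_G(Q)%G) : {set gT} :=
  [set x in 'N_G(Q) | gconj x b == b].

Definition nilpotent_block (p : nat) G (B : FG G) : Prop :=
  forall Q (b : FG 'C_G(Q)%G), subpair p B b ->
    p.-group (subpair_stab b / 'C_G(Q))%g.

End GroupAlgebra.

Section BrauerCharacters.

Variables (p : nat) (F : closedFieldType) (r : p_modular p F).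
Variables (gT : finGroupType) (G : {group gT}).

Definition p'root_of_unity (z : algC) : Prop :=
  exists2 k : nat, coprime p k & z ^+ k = 1.

(* At a p-regular element x, phi is the sum of the lifts to characteristic 0 of
   the eigenvalues of rG x; by convention phi vanishes elsewhere. *)
Definition affords_brauer n (rG : mx_representation F G n)
    (phi : {ffun gT -> algC}) : Prop :=
  (forall x, x \in G -> p^'.-elt x ->
     exists s : seq algC,
       [/\ {in s, forall z, p'root_of_unity z},
           char_poly (rG x) = \prod_(z <- s) ('X - (r z)%:P)
         & phi x = \sum_(z <- s) z])
  /\ (forall x, ~~ ((x \in G) && p^'.-elt x) -> phi x = 0).

(* A simple FG-module belongs to the block B if the idempotent B acts on it as
   the identity. *)
Definition IBr (B : 'M[F]_#|pred_of_set (gval G)|) : set {ffun gT -> algC} :=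
  [set phi | exists (n : nat) (rG : mx_representation F G n),
     [/\ mx_irreducible rG, gring_op rG B = 1%:M & affords_brauer rG phi]]%classic.

Definition l_block (B : 'M[F]_#|pred_of_set (gval G)|) : nat :=
  #|` fset_set (IBr B)|%fset.

End BrauerCharacters.

(* Main.v *)
Require Import Defs.
From HB Require Import structures.
From mathcomp Require Import all_boot all_order all_algebra all_fingroup.
From mathcomp Require Import all_solvable all_field all_character.

(* Fix a prime q <> p and an element z of order q in the centre of G, and let e
   be the idempotent of a faithful linear character of <z> over F. Suppose that
   every p-regular x outside <z> has a commutator [x, c] in <z> different from
   1 (central_type below). As [x, c] is a scalar different from 1 on every
   simple FGe-module, x has trace 0 there, and so has every element of p'-part
   x. The traces of all simple FGe-modules are thus proportional to a single
   function, whereas those of non-isomorphic simple modules are linearly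
   independent; hence FGe has only one simple module, and e is a block. Its
   coefficient at 1 is 1/q, so that no Brauer homomorphism kills it: e has
   maximal defect.
   Such groups G of arbitrary p-length are built by alternating two kinds of
   layers, starting with a cyclic group of order pq. If U is a representation
   of G with kernel <z>, over F_q the group G is extended by a Heisenberg group
   on U + U^* with centre <z>, and over F_p by the abelian group V = U + U^*.
   Adding one layer of each kind makes the upper p-series longer by two. As the
   last layer V is normal and C_G(V) = V x <z>, the idempotent e is also a block
   of C_G(V), stable under G, while a p-regular element outside <z> does not
   centralise V: the block e is not nilpotent. *)

Set Implicit Arguments.
Unset Strict Implicit.
Unset Printing Implicit Defensive.

Import GRing.Theory GroupScope.

(** * The upper p-series and the p-length *)

Lemma pgroup_elts pi (gT : finGroupType) (G : {group gT}) :
  (forall x, x \in G -> pi.-elt x) -> pi.-group G.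
Proof.
move=> piG; apply/pgroupP=> q q_pr /(Cauchy q_pr)[x Gx oxq].
by have := piG x Gx; rewrite /p_elt oxq pnatE.
Qed.

(** The regular representation of the quotient by [N] is faithful, so its inflation has kernel
    [N]. *)
Lemma repr_with_kernel (F : fieldType) (gT : finGroupType) (N : {group gT}) :
  N <| [set: gT] ->
  exists2 n, (0 < n)%N &
    exists rG : mx_representation F [set: gT] n, rker rG = N :> {set gT}.
Proof.
move=> nN; pose rQ := regular_repr F ([set: gT] / N)%G.
have eqG : coset N @*^-1 ([set: gT] / N) = [set: gT].
  by rewrite quotientGK.
exists #|([set: gT] / N)%G|; first exact: cardG_gt0.
exists (eqg_repr (morphpre_repr (coset_morphism N) rQ) (introT eqP eqG)).
rewrite rker_eqg rker_morphpre.
have -> : rker rQ = 1%G :> {set _} by apply/trivgP/regular_mx_faithful.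
by rewrite -[RHS]ker_coset.
Qed.

Lemma upper_p_seriesS p k (gT : finGroupType) (G : {group gT}) :
  upper_p_series p k.+1 G =
    pcore_mod G (if odd k then (p : nat_pred) else (p : nat_pred)^')
      (upper_p_series p k G) :> {set gT}.
Proof. by rewrite /= mkseqS pseries_rcons. Qed.

Lemma upper_p_series_normal p k (gT : finGroupType) (G : {group gT}) :
  upper_p_series p k G <| G.
Proof. exact: pseries_normal. Qed.

Section UpperSeries.
Variables (p : nat).
Implicit Types gT rT : finGroupType.
Local Notation pi k := (if odd k then (p : nat_pred) else (p : nat_pred)^').

(** With its converse [sub_upper_p_series], this describes the series through powers of elements, so
    that its terms can be moved along morphisms without forming quotients. *)
Lemma upper_p_series_elt k gT (G : {group gT}) x :
  x \in upper_p_series p k.+1 G ->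
  exists2 m, (pi k).-nat m & x ^+ m \in upper_p_series p k G.
Proof.
have [sUG nUG] := andP (upper_p_series_normal p k G).
rewrite upper_p_seriesS => Ux; have Nx : x \in 'N(upper_p_series p k G).
  by case/setIP: Ux.
exists #[coset (upper_p_series p k G) x].
  by case/morphpreP: Ux => _; apply: mem_p_elt (pcore_pgroup _ _).
by rewrite coset_idr ?groupX // morphX // expg_order.
Qed.

Lemma sub_upper_p_series k gT (G X : {group gT}) : X <| G ->
    (forall x, x \in X ->
       exists2 m, (pi k).-nat m & x ^+ m \in upper_p_series p k G) ->
  X \subset upper_p_series p k.+1 G.
Proof.
move=> nXG powX; have [sUG nUG] := andP (upper_p_series_normal p k G).
have nUX := subset_trans (normal_sub nXG) nUG.
rewrite upper_p_seriesS -sub_quotient_pre // pcore_max ?quotient_normal //.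
apply: pgroup_elts => _ /morphimP[x Nx Xx ->]; have [m pm Um] := powX x Xx.
apply: pnat_dvd pm; rewrite order_dvdn -morphX //=.
by apply/eqP/coset_id.
Qed.

(** Powers are carried along by [f], and equal parities make both series use the same set of primes
    at each step. *)
Lemma morphim_upper_p_series gT rT (G : {group gT}) (f : {morphism G >-> rT})
    i j k :
  odd i = odd j ->
  f @* upper_p_series p i G \subset upper_p_series p j (f @* G) ->
  f @* upper_p_series p (i + k) G \subset upper_p_series p (j + k) (f @* G).
Proof.
move=> eq_ij sub_ij; elim: k => [|k IHk]; first by rewrite !addn0.
rewrite !addnS; apply: sub_upper_p_series.
  by rewrite morphim_normal ?upper_p_series_normal.
move=> _ /morphimP[x Gx Ux ->]; have [m pm Um] := upper_p_series_elt Ux.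
exists m; first by move: pm; rewrite !oddD eq_ij.
rewrite -morphX // (subsetP IHk) // mem_morphim //.
by rewrite groupX.
Qed.

(** The first term absorbs a normal p'-subgroup: if [x ^+ m] lies in [N], a further power by [#|N|]
    is trivial. Term 0 does not, whence the successor. *)
Lemma upper_p_series_quotient k gT (G N : {group gT}) : N <| G -> p^'.-group N ->
  coset N @*^-1 upper_p_series p k.+1 (G / N) \subset upper_p_series p k.+1 G.
Proof.
move=> nNG p'N; elim: k => [|k IHk]; apply: sub_upper_p_series.
- by rewrite -[X in _ <| X](quotientGK nNG) cosetpre_normal upper_p_series_normal.
- move=> x /morphpreP[Nx /upper_p_series_elt[m pm]]; rewrite -morphX //= => /set1P.
  move/coset_idr=> Nxm; exists (m * #|N|)%N; first by rewrite pnatM pm.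
  by rewrite expgM inE; apply/eqP/expg_cardG/Nxm; rewrite groupX.
- by rewrite -[X in _ <| X](quotientGK nNG) cosetpre_normal upper_p_series_normal.
move=> x /morphpreP[Nx /upper_p_series_elt[m pm]]; rewrite -morphX //= => Um.
by exists m => //; rewrite (subsetP IHk) // mem_morphpre ?groupX.
Qed.

Lemma upper_p_series_sub k gT (G : {group gT}) :
  upper_p_series p k G \subset upper_p_series p k.+1 G.
Proof. by rewrite upper_p_seriesS sub_cosetpre. Qed.

Lemma upper_p_series_le i k gT (G : {group gT}) : (i <= k)%N ->
  upper_p_series p k G :!=: G -> upper_p_series p i G :!=: G.
Proof.
move/subnKC=> <-; apply: contraNneq => Gi.
rewrite eqEsubset normal_sub ?upper_p_series_normal //.
elim: (k - i)%N => [|j IHj]; first by rewrite addn0 Gi subxx.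
by rewrite addnS (subset_trans IHj) ?upper_p_series_sub.
Qed.

Lemma upper_p_series_quotientS k gT (G : {group gT}) :
  (upper_p_series p k.+1 G / upper_p_series p k G)%g
    = 'O_(pi k)(G / upper_p_series p k G).
Proof. by rewrite upper_p_seriesS quotient_pcore_mod. Qed.

(** A nontrivial solvable group has a nontrivial normal elementary abelian q-subgroup, which lies in
    O_p(G) if q = p and in O_p'(G) otherwise. *)
Lemma sol_pcore_neq1 gT (G : {group gT}) : solvable G -> G :!=: 1 ->
  'O_p(G) = 1 -> 'O_p^'(G) = 1 -> False.
Proof.
move=> solG ntG Op Op'.
have [M [_ nsMG ntM /is_abelemP[q _ /abelem_pgroup qM]]] :=
  solvable_norm_abelem solG (normal_refl G) ntG.
suff : M \subset [1] by rewrite subG1 (negPf ntM).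
have [E|Dq] := eqVneq q p; first by rewrite -Op pcore_max // -E.
rewrite -Op' pcore_max //; apply: sub_in_pnat qM => r _.
by rewrite !inE => /eqP->.
Qed.

Lemma pcore_quotient_pseries pis pis' rho gT (G : {group gT}) :
  pis' = rcons pis rho -> 'O_rho(G / pseries pis' G) = 1.
Proof.
move=> ->; rewrite -quotient_pseries pseries_rcons_id; exact: trivg_quotient.
Qed.

(** If the series stalls, the quotient by the stalled term has trivial p-core and p'-core: one
    because its prime set was just used, the other because the next term adds nothing. The step from
    term 0 to term 1 may be trivial, whence [k.+1]. *)
Lemma upper_p_series_proper k gT (G : {group gT}) : solvable G ->
  upper_p_series p k.+1 G :!=: G ->
  upper_p_series p k.+1 G \proper upper_p_series p k.+2 G.
Proof.
move=> solG ntG; rewrite properE upper_p_series_sub; apply/negP=> sU.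
have nUG := upper_p_series_normal p k.+1 G.
have Opi b : 'O_(if b then (p : nat_pred) else (p : nat_pred)^')
                (G / upper_p_series p k.+1 G) = 1.
  have [->|Db] := eqVneq b (odd k).
    exact/pcore_quotient_pseries/mkseqS.
  have -> : b = odd k.+1 by move: Db; rewrite /=; case: b (odd k) => [] [].
  rewrite -upper_p_series_quotientS; apply/trivgP.
  rewrite quotient_sub1 //; apply: subset_trans (normal_norm nUG).
  exact: normal_sub (upper_p_series_normal _ _ _).
apply: (@sol_pcore_neq1 _ (G / upper_p_series p k.+1 G)%G).
- exact: quotient_sol.
- apply: contra ntG; rewrite -subG1 quotient_sub1 ?normal_norm // eqEsubset.
  by rewrite (normal_sub nUG).
- exact: Opi true.
- exact: Opi false.
Qed.

(** Strict growth bounds the index of a proper term by its order; this keeps the indices used below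
    inside ['I_#|G|], where [p_length] counts. *)
Lemma upper_p_series_card k gT (G : {group gT}) : solvable G ->
  upper_p_series p k G :!=: G -> (k <= #|upper_p_series p k G|)%N.
Proof.
move=> solG; elim: k => // -[|k] IHk ntU; first by rewrite cardG_gt0.
have ntU' : upper_p_series p k.+1 G :!=: G.
  apply: contraNneq ntU => E; rewrite eqEsubset normal_sub ?upper_p_series_normal //.
  by rewrite -{1}E upper_p_series_sub.
apply: leq_ltn_trans (IHk ntU') _.
exact: proper_card (upper_p_series_proper solG ntU').
Qed.

Lemma p_length_ge l gT (G : {group gT}) : solvable G ->
  upper_p_series p l.*2 G :!=: G -> (l <= p_length p G)%N.
Proof.
move=> solG ntG.
have ntk k := @upper_p_series_le k l.*2 gT G ^~ ntG.
have ltG k : (k <= l.*2)%N -> (k < #|G|)%N.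
  move=> lek; apply: leq_ltn_trans (upper_p_series_card solG (ntk k lek)) _.
  by rewrite proper_card // properEneq ntk // normal_sub ?upper_p_series_normal.
have lt_i (i : 'I_l) : (i.*2.+1 < #|G|)%N.
  by apply: ltG; rewrite ltn_double.
(* The factors of odd index are the p-factors; those of index 1, 3, ..., 2l-1 are all nontrivial. *)
pose f i := Ordinal (lt_i i).
have inj_f : injective f.
  by move=> i j /(congr1 val)/= [/double_inj/val_inj].
rewrite /p_length -[leqLHS]card_ord -(card_image inj_f) subset_leq_card //.
apply/subsetP=> _ /imageP[i _ ->]; rewrite inE /=.
apply/andP; split; last first.
  rewrite upper_p_series_quotientS oddS odd_double; exact: pcore_pgroup.
have le_i : (i.*2.+1 <= l.*2)%N by rewrite ltn_double.
apply: contraL (upper_p_series_proper solG (ntk _ le_i)) => /eqP U1.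
rewrite properE negb_and negbK orbC -quotient_sub1 ?U1 ?subxx //.
apply: subset_trans (normal_norm (upper_p_series_normal _ _ _)).
exact: normal_sub (upper_p_series_normal _ _ _).
Qed.

End UpperSeries.

(** * Layers *)

Local Open Scope ring_scope.

Definition central_type (p : nat) (gT : finGroupType) (G : {group gT}) (z : gT) :=
  forall x, x \in G -> p^'.-elt x -> x \notin <[z]>%g ->
    exists2 c, c \in G & [~ x, c]%g \in (<[z]>^#)%g.

(* For a representation rho of G = gT over F_s and y in the centre of G with
   y^s = 1 and rho y = 1, the layer is the set of all (a, b, g), a being a row,
   b a column and g in G, under the product
     (a, b, g)(a', b', g')
       = (a + a' rho(g)^-1, b + rho(g) b', y^(a rho(g) b') g g').
   It is a split extension of G if y = 1. If y generates the kernel of rho, the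
   elements with g in <y> form an extraspecial group with centre <y>. *)
Record layer_data (gT : finGroupType) (s : nat) := LayerData {
  ldim : nat;
  lrepr :> mx_representation 'F_s [set: gT] ldim;
  lcoc : gT;
  lprime : prime s;
  lcocX : (lcoc ^+ s = 1)%g;
  lcocC : lcoc \in 'Z([set: gT])%g;
  lrepr_coc : lrepr lcoc = 1%:M }.

Definition layer (gT : finGroupType) (s : nat) (D : layer_data gT s) : Type :=
  'rV['F_s]_(ldim D) * 'cV['F_s]_(ldim D) * gT.

Section Layer.

Variables (gT : finGroupType) (s : nat) (D : layer_data gT s).
Local Notation n := (ldim D).
Local Notation y := (lcoc D).
Local Notation r := (lrepr D).
Local Notation L := (layer D).

HB.instance Definition _ :=
  Finite.copy L ('rV['F_s]_n * 'cV['F_s]_n * gT)%type.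

Definition lpair (a : 'rV['F_s]_n) (b : 'cV['F_s]_n) : 'F_s := (a *m b) 0 0.
Definition ycoc (t : 'F_s) : gT := (y ^+ t)%g.

Lemma ycocD t u : ycoc (t + u) = (ycoc t * ycoc u)%g.
Proof.
(* Sums in ['F_s] are reduced modulo [(Zp_trunc (pdiv s)).+2], which equals s as s is prime. *)
have yX: (y ^+ (Zp_trunc (pdiv s)).+2 = 1)%g.
  by rewrite Fp_cast ?(lprime D) ?(lcocX D).
by rewrite /ycoc -expgD -[RHS](expg_mod _ yX).
Qed.

Lemma ycoc0 : ycoc 0 = 1%g. Proof. by []. Qed.

Lemma ycocC t (g : gT) : (ycoc t * g = g * ycoc t)%g.
Proof.
apply/esym/commuteX; have [_ /centP cy] := setIP (lcocC D).
by apply/esym/cy; rewrite inE.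
Qed.

Lemma lreprM g h : r (g * h)%g = r g *m r h.
Proof. by rewrite repr_mxM ?inE. Qed.

Lemma lreprK g : r g *m r g^-1%g = 1%:M.
Proof. by rewrite -lreprM mulgV repr_mx1. Qed.

Lemma lreprVK g : r g^-1%g *m r g = 1%:M.
Proof. by rewrite -lreprM mulVg repr_mx1. Qed.

Lemma lrepr_ycoc t : r (ycoc t) = 1%:M.
Proof.
rewrite /ycoc; elim: (val t) => [|k IH]; first by rewrite repr_mx1.
by rewrite expgS lreprM IH lrepr_coc mulmx1.
Qed.

Definition layer_mul (u v : L) : L :=
  let: (a, b, g) := u in let: (a', b', g') := v in
  (a + a' *m r g^-1%g, b + r g *m b',
   (ycoc (lpair a (r g *m b')) * (g * g'))%g).

Definition layer_one : L := (0, 0, 1%g).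

Definition layer_inv (u : L) : L :=
  let: (a, b, g) := u in
  (- (a *m r g), - (r g^-1%g *m b), (ycoc (lpair a b) * g^-1)%g).

Lemma lpairDl a a' b : lpair (a + a') b = lpair a b + lpair a' b.
Proof. by rewrite /lpair mulmxDl mxE. Qed.
Lemma lpairDr a b b' : lpair a (b + b') = lpair a b + lpair a b'.
Proof. by rewrite /lpair mulmxDr mxE. Qed.
Lemma lpairNl a b : lpair (- a) b = - lpair a b.
Proof. by rewrite /lpair mulNmx mxE. Qed.
Lemma lpair0l b : lpair 0 b = 0.
Proof. by rewrite /lpair mul0mx mxE. Qed.
Lemma lpair0r a : lpair a 0 = 0.
Proof. by rewrite /lpair mulmx0 mxE. Qed.
Lemma lpairJ a A b : lpair (a *m A) b = lpair a (A *m b).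
Proof. by rewrite /lpair mulmxA. Qed.

Lemma layer_mulA : associative layer_mul.
Proof.
move=> [[a1 b1] g1] [[a2 b2] g2] [[a3 b3] g3]; rewrite /layer_mul.
rewrite !invMg !lreprM !lrepr_ycoc !mul1mx.
have -> : r (ycoc (lpair a1 (r g1 *m b2)))^-1%g = 1%:M.
  by rewrite -[LHS]mul1mx -{1}(lrepr_ycoc (lpair a1 (r g1 *m b2))) lreprK.
congr (_, _, _).
- by rewrite mulmx1 mulmxDl addrA mulmxA.
- by rewrite mulmxDr addrA mulmxA.
rewrite !mulgA -[(ycoc _ * g1 * ycoc _)%g]mulgA -ycocC !mulgA -!ycocD.
apply: (congr1 (fun t => ycoc t * g1 * g2 * g3)%g).
(* The cocycle identity: the inverse action on rows cancels the action on columns, so both sides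
   consist of the same three pairings. *)
rewrite lpairDl lpairJ mulmxDr lpairDr !mulmxA lreprVK mul1mx.
by rewrite -addrA [LHS]addrC.
Qed.

Lemma layer_mul1 : left_id layer_one layer_mul.
Proof.
move=> [[a b] g]; rewrite /layer_mul /layer_one invg1 repr_mx1 mulmx1 mul1mx.
by rewrite !add0r lpair0l ycoc0 !mul1g.
Qed.

Lemma layer_mulV : left_inverse layer_one layer_inv layer_mul.
Proof.
move=> [[a b] g]; rewrite /layer_mul /layer_one /layer_inv.
rewrite invMg invgK lreprM lreprM lrepr_ycoc mul1mx.
have -> : r (ycoc (lpair a b))^-1%g = 1%:M.
  by rewrite -[LHS]mul1mx -{1}(lrepr_ycoc (lpair a b)) lreprK.
rewrite mulmx1 !addNr; congr (_, _, _).
rewrite -mulgA mulVg mulg1 -ycocD lpairNl lpairJ mulmxA lreprK mul1mx addNr.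
by rewrite ycoc0.
Qed.

HB.instance Definition _ := Finite_isGroup.Build L layer_mulA layer_mul1 layer_mulV.

Lemma layerM a b g a' b' g' :
  (((a, b, g) : L) * ((a', b', g') : L))%g =
  (a + a' *m r g^-1%g, b + r g *m b', (ycoc (lpair a (r g *m b')) * (g * g'))%g).
Proof. by []. Qed.

Definition lemb (g : gT) : L := (0, 0, g).

Definition lvec (a : 'rV['F_s]_n) : L := (a, 0, 1%g).

Lemma lembM : {in [set: gT] &, {morph lemb : g h / (g * h)%g}}.
Proof.
move=> g h _ _; rewrite layerM mul0mx mulmx0 !addr0 lpair0l.
by rewrite ycoc0 mul1g.
Qed.
Canonical lemb_morphism := Morphism lembM.

Lemma lemb_mull g a b h :
  (lemb g * ((a, b, h) : L))%g = (a *m r g^-1%g, r g *m b, (g * h)%g).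
Proof. by rewrite layerM !add0r lpair0l ycoc0 mul1g. Qed.

Lemma lemb_mulr g a b h : (((a, b, h) : L) * lemb g)%g = (a, b, (h * g)%g).
Proof. by rewrite layerM mul0mx mulmx0 !addr0 lpair0r ycoc0 mul1g. Qed.

Lemma lembX g k : (lemb g ^+ k)%g = lemb (g ^+ k)%g.
Proof. by rewrite -morphX ?inE. Qed.

Lemma lemb_inj : injective lemb. Proof. by move=> g h []. Qed.

Lemma injm_lemb : ('injm lemb)%g.
Proof. by apply/injmP=> g h _ _ /lemb_inj. Qed.

Lemma order_lemb g : #[lemb g]%g = #[g]%g.
Proof. by rewrite (order_injm injm_lemb) ?inE. Qed.

Lemma mem_lemb g h : (lemb g \in <[lemb h]>)%g = (g \in <[h]>)%g.
Proof.
by apply/cycleP/cycleP=> -[i]; rewrite ?lembX; [move/lemb_inj | move->] => *;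
  exists i; rewrite ?lembX.
Qed.

Section Center.

Variable z : gT.
Hypothesis zC : (z \in 'Z([set: gT]))%g.
Hypothesis kerD : (rker r = <[z]>)%g.
Hypothesis yz : (y \in <[z]>)%g.

Local Notation N := <[z]>%G.

Lemma ycoc_ker t : ycoc t \in N.
Proof. by rewrite groupX. Qed.

Lemma ker_norm g : (g \in 'N(N))%g.
Proof.
have [_ /centP cz] := setIP zC.
by rewrite (subsetP (cent_sub _)) ?cent_cycle //; apply/cent1P/commute_sym/cz;
  rewrite inE.
Qed.

Lemma ker_cent g h : h \in N -> (g * h = h * g)%g.
Proof.
have [_ /centP cz] := setIP zC; case/cycleP=> i ->.
by apply: commuteX; apply/commute_sym/cz; rewrite inE.
Qed.

Lemma lrepr_ker g : (r g = 1%:M) <-> g \in N.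
Proof.
rewrite -[N : {set _}]kerD; split=> [rg | ]; last by case/rkerP.
by apply/rkerP; rewrite inE.
Qed.

Lemma lemb_ycoc_mull t a b g :
  (lemb (ycoc t) * ((a, b, g) : L))%g = (a, b, (ycoc t * g)%g).
Proof.
have /lrepr_ker rt := ycoc_ker t; have /lrepr_ker rtV := groupVr (ycoc_ker t).
by rewrite lemb_mull rt rtV mulmx1 mul1mx.
Qed.

(** The projection to [gT] is multiplicative only up to powers of [y]; modulo [<[z]>] it becomes a
    morphism. *)
Definition lquo (u : L) : coset_of N := coset N u.2.

Lemma lquoM : {in [set: L] &, {morph lquo : u v / (u * v)%g}}.
Proof.
move=> [[a b] g] [[a' b'] h] _ _; rewrite layerM /lquo /=.
by rewrite coset_kerl ?ycoc_ker // morphM ?ker_norm.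
Qed.
Canonical lquo_morphism := Morphism lquoM.

Lemma lquo_eq1 u : (lquo u = 1%g) <-> u.2 \in N.
Proof. by split=> [/coset_idr-> // |/coset_id]; rewrite ?ker_norm. Qed.

Lemma lemb_center : (lemb z \in 'Z([set: L]))%g.
Proof.
rewrite inE inE; apply/centP=> -[[a b] g] _.
have rz : r z = 1%:M by apply/lrepr_ker/cycle_id.
have rzV : r z^-1%g = 1%:M by apply/lrepr_ker; rewrite groupV cycle_id.
rewrite /commute lemb_mull lemb_mulr rz rzV mulmx1 mul1mx.
by rewrite (ker_cent g (cycle_id z)).
Qed.

Lemma lemb_central g (u : L) : g \in N -> (lemb g * u = u * lemb g)%g.
Proof.
have [_ /centP cz] := setIP lemb_center.
case/cycleP=> i ->; rewrite -lembX; apply/commute_sym/commuteX/commute_sym.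
by apply: cz; rewrite inE.
Qed.

Lemma comm_lemb g (u v : L) : g \in N -> (u * v = lemb g * (v * u))%g ->
  [~ u, v]%g = lemb g.
Proof.
move=> gN E; have -> : [~ u, v]%g = ((v * u)^-1 * (u * v))%g.
  by rewrite invMg -mulgA.
by rewrite E (lemb_central _ gN) mulKg.
Qed.

(** Elements over [<[z]>] act trivially on vectors, so their commutator is the power of [y] given by
    the symplectic form [lpair a b' - lpair a' b]. *)
Lemma layer_ker_comm (u v : L) : u.2 \in N -> v.2 \in N ->
  exists2 g, g \in N & (u * v = lemb g * (v * u))%g.
Proof.
case: u v => [[a b] g] [[a' b'] h] /= gN hN.
have /lrepr_ker rg := gN; have /lrepr_ker rh := hN.
have /lrepr_ker rgV := groupVr gN; have /lrepr_ker rhV := groupVr hN.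
pose k := (ycoc (lpair a b' - lpair a' b)%R).
exists k; first exact: ycoc_ker.
have /lrepr_ker rk : k \in N by apply: ycoc_ker.
have /lrepr_ker rkV : k^-1%g \in N by rewrite groupV ycoc_ker.
rewrite !layerM rg rh rgV rhV rk rkV !mulmx1 !mul1mx !add0r lpair0l ycoc0 mul1g.
rewrite [a + a']addrC [b + b']addrC; congr (_, _, _).
by rewrite [RHS]mulgA /k -ycocD subrK (ker_cent h gN).
Qed.

(** The kernel of [lquo] has its derived subgroup in the image of [<[z]>], and the quotient by it
    embeds in the solvable group [gT / <[z]>]. *)
Lemma layer_solvable : solvable [set: gT] -> solvable [set: L].
Proof.
move=> solG; have nsK := ker_normal lquo_morphism.
rewrite (series_sol nsK) (isog_sol (first_isog lquo_morphism)).
have solQ : solvable [set: coset_of N].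
  suff -> : [set: coset_of N] = ([set: gT] / N)%g by exact: quotient_sol.
  apply/eqP; rewrite eqEsubset subsetT andbT; apply/subsetP=> x _.
  by rewrite -[x]coset_reprK mem_quotient ?inE.
rewrite (solvableS _ solQ) ?subsetT ?andbT //.
have sKE : (('ker lquo)^`(1) \subset lemb @* <[z]>)%g.
  rewrite gen_subG; apply/subsetP=> _ /imset2P[u v Ku Kv ->].
  have /lquo_eq1 uN := mker Ku; have /lquo_eq1 vN := mker Kv.
  have [g gN E] := layer_ker_comm uN vN.
  rewrite (comm_lemb gN E).
  exact: mem_morphim.
apply/derivedP; exists 2; rewrite dergSn; apply/derG1P.
by apply: abelianS sKE _; rewrite morphim_abelian ?cycle_abelian.
Qed.

Lemma mem_cycle_lembP (u : L) :
  reflect (u.1 = 0 /\ u.2 \in N) (u \in <[lemb z]>%g).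
Proof.
apply: (iffP idP) => [|[u0 uN]].
  by case/cycleP=> i ->; rewrite lembX; split; rewrite ?mem_cycle.
by move: u0 uN; case: u => _ g /= -> gN; rewrite -[(0, g)]/(lemb g) mem_lemb.
Qed.

(** The first coordinates of the two products show that [u.2] fixes every row [a]; standard basis
    rows suffice. *)
Lemma layer_act_trivial (u : L) :
  (forall a, exists2 g, g \in N &
     (u * lvec a = lemb g * (lvec a * u))%g) -> u.2 \in N.
Proof.
case: u => -[a0 b0] h /= act; rewrite -groupV; apply/lrepr_ker/row_matrixP=> i.
have [g /groupVr/lrepr_ker rg] := act (row i 1%:M).
rewrite !layerM => -[+ _ _]; rewrite rg mulmx1 invg1 repr_mx1 mulmx1 add0r addrC.
by move/addIr; rewrite -row_mul mul1mx.
Qed.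

Lemma layerX_ker (u : L) k : u.2 \in N ->
  (u ^+ k)%g.1 = (u.1.1 *+ k, u.1.2 *+ k) /\ (u ^+ k)%g.2 \in N.
Proof.
case: u => -[a b] g /= gN; have /lrepr_ker rg := gN.
have /lrepr_ker rgV := groupVr gN.
elim: k => [|k]; first by split; last exact: group1.
rewrite expgS; case: (_ ^+ k)%g => _ h /= [-> hN]; rewrite layerM rg rgV mulmx1 mul1mx.
by rewrite !mulrS; split=> //; rewrite !groupM ?ycoc_ker.
Qed.

(** Over [<[z]>], taking k-th powers multiplies the vector coordinates by k, which is invertible in
    ['F_s]. *)
Lemma layer_coprime_ker (u : L) k : coprime s k -> u.2 \in N ->
  (u ^+ k)%g \in <[lemb z]>%g -> u \in <[lemb z]>%g.
Proof.
move=> co_sk uN /mem_cycle_lembP[+ _]; have [-> _] := layerX_ker k uN.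
case=> + +.
have k0 : (k%:R : 'F_s) != 0.
  by rewrite -(dvdn_pcharf (pchar_Fp (lprime D))) -prime_coprime ?(lprime D).
move=> /eqP; rewrite -scaler_nat scaler_eq0 (negPf k0) /= => /eqP a0.
move=> /eqP; rewrite -scaler_nat scaler_eq0 (negPf k0) /= => /eqP b0.
by apply/mem_cycle_lembP; split=> //; rewrite [LHS]surjective_pairing a0 b0.
Qed.

(** Duality: some column of the cokernel matrix separates [a] from the row space of [A]. *)
Lemma not_submx_ker (a : 'rV['F_s]_n) (A : 'M_n) :
  ~~ (a <= A)%MS -> exists2 b : 'cV_n, A *m b = 0 & lpair a b != 0.
Proof.
rewrite submxE => nz; pose C := cokermx A.
have [j nzj] : exists j, (a *m C) 0 j != 0.
  apply/existsP; apply: contraNT nz => /existsPn h0.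
  by apply/eqP/rowP=> j; rewrite [RHS]mxE; apply/eqP; rewrite -[_ == _]negbK h0.
exists (col j C); first by rewrite colE mulmxA mulmx_coker mul0mx.
by rewrite /lpair colE mulmxA -colE mxE.
Qed.

Lemma not_submx_ker' (b : 'cV['F_s]_n) (A : 'M_n) :
  ~~ (b^T <= A^T)%MS -> exists2 a : 'rV_n, a *m A = 0 & lpair a b != 0.
Proof.
move/not_submx_ker=> [c Ac nz_c]; exists c^T.
  by apply: trmx_inj; rewrite trmx_mul trmxK Ac trmx0.
by rewrite /lpair -[b]trmxK -trmx_mul mxE.
Qed.

Lemma ycoc_neq1 t : y != 1%g -> t != 0 -> ycoc t != 1%g.
Proof.
move=> ny t0; rewrite /ycoc -order_dvdn.
have -> : #[y]%g = s.
  by apply: nt_prime_order (lprime D) (lcocX D) ny.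
apply: contra t0 => dvd_t; apply/eqP/val_inj/eqP => /=.
rewrite -leqn0 leqNgt; apply/negP=> t_gt0.
by have := dvdn_leq t_gt0 dvd_t; rewrite leqNgt -{2}(Fp_cast (lprime D)) ltn_ord.
Qed.

Lemma layer_conj (a : 'rV['F_s]_n) (b : 'cV['F_s]_n) g :
  (a <= 1%:M - r g^-1%g)%MS -> (b^T <= (1%:M - r g)^T)%MS ->
  exists (h : L) k, ((a, b, g) : L)%g = (lemb k ^ h)%g.
Proof.
case/submxP=> a0 Ea /submxP[b0 Eb].
have {}Eb : b = b0^T - r g *m b0^T.
  by rewrite -[b]trmxK Eb trmx_mul trmxK mulmxBl mul1mx.
have {}Ea : a = a0 - a0 *m r g^-1%g by rewrite Ea mulmxBr mulmx1.
pose h : L := (a0, b0^T, 1%g).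
(* The third coordinate of [(a, b, g) * h = h * lemb k] forces this power of [y]. *)
pose k := (ycoc (lpair a (r g *m b0^T)) * g)%g.
exists h^-1%g, k; apply: (mulIg h); rewrite conjgE invgK mulgA mulgVK lemb_mulr.
rewrite layerM mulg1 mul1g; congr (_, _, _); first by rewrite Ea subrK.
by rewrite Eb subrK.
Qed.

(** The commutator found in [gT] is conjugated by [h]; it stays in the image of [<[z]>], which is
    central. *)
Lemma central_type_lemb p k (h : L) : central_type p [set: gT] z ->
  p^'.-elt (lemb k ^ h)%g -> (lemb k ^ h)%g \notin <[lemb z]>%g ->
  exists2 c : L, c \in [set: L]%g & [~ lemb k ^ h, c]%g \in (<[lemb z]>^#)%g.
Proof.
move=> ctG pk; rewrite -mem_conjgV.
have zJ v : (<[lemb z]> :^ v = <[lemb z]>)%g.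
  apply/normP; rewrite (subsetP (cent_sub _)) // cent_cycle; apply/cent1P.
  exact/commute_sym/lemb_central/cycle_id.
rewrite zJ mem_lemb => nk; have [||c _ /setD1P[nc ck]] := ctG k _ _ nk.
- by rewrite inE.
- by move: pk; rewrite /p_elt orderJ order_lemb.
exists (lemb c ^ h)%g; first by rewrite inE.
rewrite -conjRg -morphR ?inE //= conjg_eq1 (morph_injm_eq1 injm_lemb) ?inE // nc.
by rewrite -mem_conjgV zJ mem_lemb.
Qed.

(* If (a, b) = h - g.h for some h, then (a, b, g) is conjugate to an element of
   gT. Otherwise, by duality, some c fixed by g pairs nontrivially with a or b,
   and c commutes with (a, b, g) up to a nontrivial power of y. *)
Lemma layer_central_type p : y != 1%g ->
  central_type p [set: gT] z -> central_type p [set: L] (lemb z).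
Proof.
move=> ny ctG -[[a b] g] _ pu nu.
have [/andP[sa sb]|ab] :=
  boolP ((a <= 1%:M - r g^-1%g)%MS && (b^T <= (1%:M - r g)^T)%MS).
  have [h [k E]] := layer_conj sa sb; rewrite {}E in pu nu *.
  exact: central_type_lemb ctG pu nu.
have comm_ok (c : L) t : t != 0 ->
    (((a, b, g) : L) * c = lemb (ycoc t) * (c * (a, b, g)))%g ->
    exists2 c : L, c \in [set: L]%g &
      [~ ((a, b, g) : L), c]%g \in (<[lemb z]>^#)%g.
  move=> t0 E; exists c; first by rewrite inE.
  rewrite (comm_lemb (ycoc_ker t) E) in_setD1 mem_lemb ycoc_ker andbT.
  by rewrite (morph_injm_eq1 injm_lemb) ?inE ?ycoc_neq1.
move: ab; rewrite negb_and => /orP[/not_submx_ker | /not_submx_ker'] [c].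
  rewrite mulmxBl mul1mx => /(canRL (subrK _)); rewrite add0r => rc nc.
  have {}rc : r g *m c = c by rewrite {1}rc mulmxA lreprK mul1mx.
  apply: (comm_ok ((0, c, 1%g) : L) _ nc).
  have -> : (((0, c, 1%g) : L) * (a, b, g))%g = (a, c + b, g).
    by rewrite layerM invg1 repr_mx1 mulmx1 mul1mx add0r lpair0l ycoc0 !mul1g.
  by rewrite lemb_ycoc_mull layerM mul0mx addr0 rc mulg1 [c + b]addrC.
rewrite mulmxBr mulmx1 => /(canRL (subrK _)); rewrite add0r => rc nc.
have {}rc : c *m r g^-1%g = c by rewrite {1}rc -mulmxA lreprK mulmx1.
apply: (comm_ok ((- c, 0, 1%g) : L) _ nc).
have -> : (((- c, 0, 1%g) : L) * (a, b, g))%g =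
    (a - c, b, (ycoc (- lpair c b) * g)%g).
  by rewrite layerM invg1 repr_mx1 mulmx1 mul1mx add0r mul1g lpairNl addrC.
rewrite lemb_ycoc_mull layerM mulmx0 addr0 mulNmx rc mulg1 mulgA -ycocD subrr.
by rewrite lpair0r.
Qed.

(** * The split case y = 1 *)

Section Split.

Hypothesis y1 : y = 1%g.

Lemma ycoc_triv t : ycoc t = 1%g. Proof. by rewrite /ycoc y1 expg1n. Qed.

Definition lproj (u : L) : gT := u.2.
Lemma lprojM : {in [set: L] &, {morph lproj : u v / (u * v)%g}}.
Proof. by move=> [[a b] g] [[a' b'] h] _ _; rewrite layerM ycoc_triv mul1g. Qed.
Canonical lproj_morphism := Morphism lprojM.

Lemma lproj_pgroup : s.-group ('ker lproj)%g.
Proof.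
apply: pgroup_elts => u Ku; have u2 : u.2 = 1%g := mker Ku.
have uN : u.2 \in N by rewrite u2 group1.
have dvd_s : (#[u]%g %| s)%N.
  rewrite order_dvdn; have [E _] := layerX_ker s uN.
  have E2 : (u ^+ s)%g.2 = 1%g.
    by rewrite -[LHS]/(lproj _) morphX ?inE //= /lproj u2 expg1n.
  rewrite [(u ^+ s)%g]surjective_pairing E E2.
  have s0 : s%:R = 0 :> 'F_s by apply: pchar_Fp_0 (lprime D).
  by rewrite -!scaler_nat s0 !scale0r.
exact: pnat_dvd dvd_s (pnat_id (lprime D)).
Qed.

(** The kernel [V] of the projection is an s-group, so for an s'-element (a, b, g) the group
    generated by [lemb g] is a Hall s'-subgroup of its product with [V]. Hall's theorem conjugates
    (a, b, g) into it, hence into the copy of [gT]. *)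
Lemma split_central_type : solvable [set: gT] ->
  central_type s [set: gT] z -> central_type s [set: L] (lemb z).
Proof.
move=> solG ctG -[[a b] g] _ pu nu.
pose V := ('ker lproj_morphism)%G; pose K := <[lemb g]>%G.
have pg : (s^').-elt (lemb g).
  rewrite /p_elt order_lemb -[g]/(lproj (a, b, g)).
  by apply: morph_p_elt pu; rewrite ?inE.
have nVK : K \subset ('N(V))%g.
  by apply: subset_trans (subsetT _) (normal_norm (ker_normal _)).
have defVK : (V * K = V <*> K)%g by rewrite norm_joinEr.
have hallK : (s^').-Hall(V <*> K)%g K.
  by have [] := coprime_mulpG_Hall defVK lproj_pgroup pg.
have VKu : (((a, b, g) : L) \in V <*> K)%g.
  rewrite -defVK; apply/mulsgP; exists ((a, b, 1%g) : L) (lemb g).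
  - by apply/kerP; rewrite ?inE.
  - exact: cycle_id.
  by rewrite lemb_mulr mul1g.
have solVK : solvable (V <*> K)%G.
  by apply: solvableS (layer_solvable solG); apply: subsetT.
have [||h _] := @Hall_subJ _ _ _ _ <[((a, b, g) : L)%g]>%G solVK hallK.
- by rewrite cycle_subG.
- exact: pu.
rewrite cycle_subG => /imsetP[_ /cycleP[k ->] E].
rewrite lembX in E; rewrite {}E in pu nu *.
exact: central_type_lemb ctG pu nu.
Qed.

Lemma cent_ker_lproj (u : L) : u \in ('C('ker lproj))%g -> u.2 \in N.
Proof.
move/centP=> cu; apply: layer_act_trivial => c; exists 1%g; first exact: group1.
rewrite (morph1 lemb_morphism) mul1g; apply: cu.
by apply/kerP; rewrite ?inE.
Qed.

(** An element centralising the vectors lies over [<[z]>]; its order is prime to s, and that power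
    of it is 1, so its vector part vanishes. *)
Lemma cent_ker_lproj_p'elt (u : L) : u \in ('C('ker lproj))%g ->
  (s^').-elt u -> u \in <[lemb z]>%g.
Proof.
move=> /cent_ker_lproj uN pu; apply: (@layer_coprime_ker u #[u]%g) uN _; last first.
  by rewrite expg_order group1.
by rewrite prime_coprime ?(lprime D) // -p'natE ?(lprime D).
Qed.

End Split.

End Center.
End Layer.

Local Close Scope ring_scope.

(** * Towers of layers *)

(** The last clause carries the growth of the p-length through the induction: term m has not yet
    reached the whole group. *)
Definition tower (p q m : nat) (gT : finGroupType) (z : gT) :=
  [/\ solvable [set: gT], z \in 'Z([set: gT]), #[z] = q,
      central_type p [set: gT] z & upper_p_series p m [set: gT]%G :!=: [set: gT]].

(** In a cyclic group of order pq all p-regular elements lie in the subgroup of order q, so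
    [central_type] is vacuous, and a generator is not in O_p'. *)
Lemma tower_base p q : prime p -> prime q -> p != q ->
  exists (gT : finGroupType) (z : gT), tower p q 1 z.
Proof.
move=> p_pr q_pr neq_pq; have p_gt0 := prime_gt0 p_pr.
have pq_gt1 : (1 < p * q)%N.
  by rewrite (leq_trans (prime_gt1 p_pr)) // leq_pmulr ?prime_gt0.
pose gT : finGroupType := 'Z_(p * q).
have oZ : #[Zp1 : gT] = (p * q)%N by rewrite order_Zp1 Zp_cast.
have defZ : [set: gT] = <[Zp1 : gT]>.
  by apply/esym/eqP; rewrite eqEcard subsetT -orderE oZ cardsT card_ord Zp_cast /=.
have cZ : abelian [set: gT] by rewrite defZ cycle_abelian.
pose z : gT := (Zp1 : gT) ^+ p.
have oz : #[z] = q.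
  by rewrite orderXgcd oZ (gcdn_idPr _) ?dvdn_mulr // mulKn.
exists gT, z; split=> //.
- exact: abelian_sol.
- by rewrite (center_idP cZ) inE.
- move=> x _ px /negP[]; rewrite -cycle_subG.
  have cycZ : cyclic [set: gT] by rewrite defZ cycle_cyclic.
  rewrite -(cardSg_cyclic cycZ) ?subsetT // -!orderE oz.
  have co_xp : coprime #[x] p by rewrite coprime_sym prime_coprime // -p'natE.
  by rewrite -(Gauss_dvdr _ co_xp) -oZ [#[Zp1]]orderE -defZ order_dvdG ?inE.
apply/negP => /eqP U1.
have [] := @upper_p_series_elt p 0 _ [set: gT]%G (Zp1 : gT); first by rewrite U1 inE.
move=> m pm /set1P/eqP; rewrite -order_dvdn oZ => dvd_m.
have := pnat_dvd (dvdn_trans (dvdn_mulr _ (dvdnn p)) dvd_m) pm.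
by rewrite pnatE // !inE eqxx.
Qed.

Lemma normal_p'group_cent p (gT : finGroupType) (G A B : {group gT}) :
  A <| G -> B <| G -> p.-group A -> p^'.-group B -> B \subset 'C(A).
Proof.
move=> nAG nBG pA p'B; apply/commG1P/trivgP.
rewrite -(coprime_TIg (pnat_coprime pA p'B)) setIC commg_subI // subsetI subxx /=.
  exact: subset_trans (normal_sub nBG) (normal_norm nAG).
exact: subset_trans (normal_sub nAG) (normal_norm nBG).
Qed.

(** * The first terms of the upper p-series above two layers *)

Section TwoLayers.

Variables (p q : nat) (gT : finGroupType) (z : gT).
Variables (D1 : layer_data gT q) (D2 : layer_data (layer D1) p).
Hypotheses (p_pr : prime p) (q_pr : prime q) (neq_pq : p != q).
Hypotheses (zC : z \in 'Z([set: gT])) (oz : #[z] = q).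
Hypotheses (ker1 : rker (lrepr D1) = <[z]>) (y1 : lcoc D1 \in <[z]>).
Local Notation z1 := (lemb D1 z).
Hypotheses (ker2 : rker (lrepr D2) = <[z1]>) (y2 : lcoc D2 = 1).

Let z1C : z1 \in 'Z([set: layer D1]) := @lemb_center _ _ D1 z zC ker1.
Let yz2 : lcoc D2 \in <[z1]>. Proof. by rewrite y2 group1. Qed.

Local Notation U k := (upper_p_series p k [set: layer D2]%G).

(** O_p' centralises the normal p-subgroup of vectors of the top layer, hence acts trivially on
    it. *)
Lemma upper1_two_layers w : w \in U 1 -> w.2 \in <[z1]>.
Proof.
move=> Uw; apply: (cent_ker_lproj ker2 (y1 := y2)).
have pV := lproj_pgroup ker2 yz2 y2.
have p'U : p^'.-group (U 1).
  apply: pgroup_elts => x /upper_p_series_elt[k pk /set1P xk].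
  by apply: pnat_dvd pk; rewrite order_dvdn xk.
have nUG := upper_p_series_normal p 1 [set: layer D2]%G.
have nVG := ker_normal (lproj_morphism y2).
exact: (subsetP (normal_p'group_cent nVG nUG pV p'U)).
Qed.

(* The image of O_p'p in layer D1 normalises the q-group of the elements with
   g in <z>, and it is a p-group modulo <z1>, so both commute modulo <z1>. *)
Lemma upper2_two_layers w : w \in U 2 -> w.2.2 \in <[z]>.
Proof.
move=> Uw; apply: (layer_act_trivial ker1) => a.
pose m1 := w.2; pose v := (@lvec _ _ D1 a).
pose c := [~ m1, v].
have cN : c.2 \in <[z]>.
  apply/(lquo_eq1 zC).
  rewrite -[lquo _ _]/(lquo_morphism zC y1 c) morphR ?inE //=.
  by rewrite [lquo z v]coset_id ?group1 // commg1.
have [k pk ck] : exists2 k, p.-nat k & c ^+ k \in <[z1]>.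
  have Uc : [~ w, lemb D2 v] \in U 2.
    rewrite groupM ?groupV // memJ_norm //.
    have /normal_norm/subsetP-> // := upper_p_series_normal p 2 [set: layer D2]%G.
  have [k pk /upper1_two_layers Uck] := upper_p_series_elt Uc.
  exists k => //; move: Uck; rewrite -[_.2]/(lproj_morphism y2 _).
  by rewrite morphX ?inE //= morphR ?inE.
have cz : c \in <[z1]>.
  apply: (layer_coprime_ker ker1 y1 (k := k)) => //.
  apply: (@p'nat_coprime p) => //.
  by rewrite pnatE // !inE eq_sym.
exists c.2 => //.
have -> : lemb D1 c.2 = c.
  by have [c1 _] := mem_cycle_lembP _ _ cz; rewrite [RHS]surjective_pairing c1.
have [_ /centP cC] := setIP z1C.
have /cycleP[i ci] := cz.
rewrite -/m1 -/v commgC -/c ci; apply: commuteX.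
by apply/commute_sym/cC; rewrite inE.
Qed.

(** The map onto [gT / <[z]>] kills [U 2], so it sends term m+3 into term m+1, the shift by two
    preserving parity. As [<[z]>] is a p'-group, term m+1 of the quotient pulls back into term m+1
    of [gT]. *)
Lemma tower_layer_upper m :
  upper_p_series p m.+1 [set: gT]%G :!=: [set: gT] ->
  U m.+3 :!=: [set: layer D2].
Proof.
apply: contraNneq => UT.
pose N := <[z]>%G; pose f (w : layer D2) := coset N w.2.2.
have fM : {in [set: layer D2] &, {morph f : u w / u * w}}.
  move=> u w _ _; rewrite -[LHS]/(lquo_morphism zC y1 (lproj_morphism y2 (u * w))).
  by rewrite !morphM ?inE.
pose fm := Morphism fM.
have nNG : N <| [set: gT].
  rewrite /normal subsetT; apply: cents_norm; rewrite centsC cycle_subG.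
  by case/setIP: zC.
have nN x : x \in 'N(N) by rewrite (subsetP (normal_norm nNG)) ?inE.
have fT : (fm @* [set: layer D2] = [set: gT] / N)%G.
  apply/val_inj/eqP; rewrite /= eqEsubset; apply/andP; split; apply/subsetP.
    by move=> _ /morphimP[w _ _ ->]; apply: mem_quotient; rewrite inE.
  move=> _ /morphimP[x _ _ ->]; apply/morphimP.
  by exists (lemb D2 (lemb D1 x)); rewrite ?inE.
have p'N : p^'.-group N.
  by rewrite /pgroup -orderE oz pnatE // !inE eq_sym.
have U2 : fm @* U 2 \subset upper_p_series p 0 (fm @* [set: layer D2]).
  apply/subsetP=> _ /morphimP[w _ Uw ->]; apply/set1P/coset_id.
  exact: upper2_two_layers Uw.
have := morphim_upper_p_series m.+1 (erefl : odd 2 = odd 0) U2.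
rewrite !addSn add0n UT fT [fm @* _](congr1 val fT) => sU.
rewrite eqEsubset subsetT /=.
apply: subset_trans (upper_p_series_quotient m nNG p'N).
by apply/subsetP=> x _; rewrite mem_morphpre // (subsetP sU) // mem_quotient ?inE.
Qed.

End TwoLayers.

(** The first layer is over ['F_q] with cocycle in [z], the second over ['F_p] and split. The
    element [x] and the subgroup [Q] are the data that will exclude nilpotency. *)
Lemma tower_step p q m (gT : finGroupType) (z : gT) : prime p -> prime q -> p != q ->
  tower p q m.+1 z ->
  exists (hT : finGroupType) (u : hT),
   [/\ tower p q m.+3 u,
     exists2 x, p^'.-elt x & x \notin <[u]>
   & exists Q : {group hT}, [/\ Q <| [set: hT], p.-group Q &
       forall x, x \in 'C(Q) -> p^'.-elt x -> x \in <[u]>]].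
Proof.
move=> p_pr q_pr neq_pq [solG zC oz ctG ntG].
have zX : z ^+ q = 1 by rewrite -oz expg_order.
have nz (hT : finGroupType) (x : hT) : x \in 'Z([set: hT]) -> <[x]> <| [set: hT].
  move=> xC; rewrite /normal subsetT; apply: cents_norm; rewrite centsC.
  by rewrite cycle_subG; case/setIP: xC.
have [n1 n1_gt0 [r1 ker1]] := @repr_with_kernel 'F_q _ _ (nz _ _ zC).
have r1z : r1 z = 1%:M%R.
  by have /rkerP[] : z \in rker r1 by rewrite ker1 cycle_id.
pose D1 := @LayerData _ _ _ r1 z q_pr zX zC r1z.
pose z1 : layer D1 := lemb D1 z.
have z1C : z1 \in 'Z([set: layer D1]) := @lemb_center _ _ D1 z zC ker1.
have [n2 n2_gt0 [r2 ker2]] := @repr_with_kernel 'F_p _ _ (nz _ _ z1C).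
have C1 : 1 \in 'Z([set: layer D1]) by apply: group1.
pose D2 := @LayerData _ _ _ r2 1 p_pr (expg1n _ _) C1 (repr_mx1 r2).
pose z2 : layer D2 := lemb D2 z1.
have yz1 : lcoc D1 \in <[z]> by apply: cycle_id.
have yz2 : lcoc D2 \in <[z1]> by apply: group1.
have z2C : z2 \in 'Z([set: layer D2]) := @lemb_center _ _ D2 z1 z1C ker2.
have ctL1 : central_type p [set: layer D1] z1.
  apply: (@layer_central_type _ _ D1 z) ctG => //.
  by rewrite -order_gt1 /= oz prime_gt1.
have solL1 : solvable [set: layer D1] by apply: (@layer_solvable _ _ D1 z) solG.
exists (layer D2), z2; split.
- split=> //.
  + by apply: (@layer_solvable _ _ D2 z1) solL1.
  + by rewrite !order_lemb.
  + by apply: (@split_central_type _ _ D2 z1) ctL1.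
  exact: (@tower_layer_upper p q _ z D1 D2).
(* A nonzero vector of the first layer lies outside [<[z1]>], and its order divides q^2. *)
- pose a : 'rV['F_q]_n1 := const_mx 1%R.
  have nz_a : a != 0%R.
    apply/eqP => /rowP/(_ (Ordinal n1_gt0))/eqP; rewrite !mxE.
    by rewrite oner_eq0.
  exists (lemb D2 (@lvec _ _ D1 a)); last first.
    rewrite mem_lemb; apply: contra nz_a => /(@mem_cycle_lembP _ _ D1 z)[] //.
    by case=> /eqP.
  rewrite /p_elt order_lemb.
  have vq : @lvec _ _ D1 a ^+ q \in <[z1]>.
    have [] := @layerX_ker _ _ D1 z ker1 yz1 (@lvec _ _ D1 a) q (group1 _).
    have q0 : (q%:R = 0 :> 'F_q)%R by apply: pchar_Fp_0.
    rewrite -!scaler_nat q0 !scale0r => E1 E2.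
    by apply/(@mem_cycle_lembP _ _ D1 z).
  have /pnat_dvd-> // : #[@lvec _ _ D1 a] %| q * q.
    rewrite order_dvdn expgM -order_dvdn; have /order_dvdG := vq.
    by rewrite -orderE order_lemb oz.
  by rewrite pnatM !pnatE // !inE eq_sym neq_pq.
exists ('ker (lproj_morphism (erefl : lcoc D2 = 1))); split.
- exact: ker_normal.
- by apply: (@lproj_pgroup _ _ D2 z1).
by move=> x; apply: (@cent_ker_lproj_p'elt _ _ D2 z1).
Qed.

Lemma tower_exists p q k : prime p -> prime q -> p != q ->
  exists (gT : finGroupType) (z : gT), tower p q k.*2.+1 z.
Proof.
move=> p_pr q_pr neq_pq; elim: k => [|k [gT [z zt]]]; first exact: tower_base.
have [hT [u [ut _ _]]] := tower_step p_pr q_pr neq_pq zt.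
by exists hT, u.
Qed.

Lemma prime_neq p : exists2 q, prime q & p != q.
Proof. by have [->|] := eqVneq p 2; [exists 3 | exists 2]. Qed.

Local Open Scope ring_scope.

(** * Traces of simple modules in characteristic p *)

Lemma exprB_pchar_comm (R : nzRingType) p k (x y : R) :
  p \in [pchar R] -> GRing.comm x y ->
  (x - y) ^+ (p ^ k) = x ^+ (p ^ k) - y ^+ (p ^ k).
Proof.
move=> pR cxy; elim: k => [|k IHk]; first by rewrite !expr1.
have cxyk : GRing.comm (x ^+ (p ^ k)) (y ^+ (p ^ k)).
  by apply: commrX; apply/commr_sym/commrX/commr_sym.
by rewrite expnSr !exprM IHk -!(pFrobenius_autE pR) pFrobenius_autB_comm.
Qed.

(** All eigenvalues are 0, so the characteristic polynomial is a power of 'X. *)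
Lemma nilpotent_mxtrace (F : closedFieldType) n (A : 'M[F]_n) k :
  A ^+ k = 0 -> \tr A = 0.
Proof.
case: n A => [|n] A Ak0; first by rewrite /mxtrace big_ord0.
apply: oppr_inj; rewrite -char_poly_trace // oppr0.
have [s Es] := closed_field_poly_normal (char_poly A).
have {}Es : char_poly A = \prod_(a <- s) ('X - a%:P).
  by rewrite Es (monicP (char_poly_monic A)) scale1r.
have s0 : all (pred1 0) s.
  apply/allP=> a sa /=; have : eigenvalue A a.
    by rewrite eigenvalue_root_char Es root_prod_XsubC.
  case/eigenvalueP=> v vA nz_v.
  have vAk i : v *m (A ^+ i) = a ^+ i *: v.
    elim: i => [|i IHi]; first by rewrite !expr0 scale1r mulmx1.
    by rewrite !exprS mulmxA vA -scalemxAl IHi scalerA.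
  have /eqP := vAk k; rewrite Ak0 mulmx0 eq_sym scaler_eq0 (negPf nz_v) orbF.
  by rewrite expf_eq0 => /andP[].
have := size_char_poly A; rewrite {1}Es size_prod_XsubC => -[sz].
rewrite Es (all_pred1P _ _ s0) big_nseq subr0 iter_mulr_1 coefXn sz.
by rewrite -[_ == _]negbK neq_ltn ltnSn.
Qed.

Section Traces.

Variables (p : nat) (F : closedFieldType) (gT : finGroupType) (G : {group gT}).
Hypothesis charF : p \in [pchar F].

(** The matrices of [x] and of its p'-part commute and have the same p^k-th power, p^k being the
    order of the p-part; in characteristic p their difference is nilpotent. *)
Lemma mxtrace_p'constt n (rG : mx_representation F G n) x : x \in G ->
  \tr (rG x) = \tr (rG x.`_p^')%g.
Proof.
move=> Gx; case: n rG => [|n] rG; first by rewrite /mxtrace !big_ord0.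
have Gx' : x.`_p^'%g \in G by rewrite groupX.
apply/eqP; rewrite -subr_eq0 -raddfB; apply/eqP.
have [k ok] := p_natP (p_elt_constt p x).
apply: (@nilpotent_mxtrace _ _ _ (p ^ k)).
have pM : p \in [pchar 'M[F]_n.+1].
  rewrite inE (pcharf_prime charF) -[_%:R]/(1%:M *+ p) -scaler_nat.
  by rewrite (pcharf0 charF) scale0r eqxx.
rewrite exprB_pchar_comm //; last first.
  rewrite /GRing.comm -!mulmxE -!repr_mxM //; congr (rG _).
  exact: commuteX (commute_refl x).
rewrite -!repr_mxX // -{1}(consttC p x) expgMn; last exact: commuteX2 (commute_refl x).
by rewrite -ok expg_order mul1g subrr.
Qed.

Lemma mxtrace_central n (rG : mx_representation F G n) a x c :
  x \in G -> c \in G -> rG [~ x, c]%g = a%:M -> a != 1 -> \tr (rG x) = 0.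
Proof.
move=> Gx Gc rc a1; have Gxc : [~ x, c]%g \in G by rewrite groupR.
have : \tr (rG (x ^ c)%g) = \tr (rG x).
  rewrite /conjg !repr_mxM ?groupV ?groupM // mxtrace_mulC -mulmxA -repr_mxM ?groupV //.
  by rewrite mulgV repr_mx1 mulmx1.
rewrite conjg_mulR repr_mxM // rc mul_mx_scalar mxtraceZ => /eqP.
rewrite -subr_eq0 -{2}[\tr _]mul1r -mulrBl mulf_eq0 subr_eq0 (negPf a1).
by move/eqP.
Qed.

End Traces.

Lemma delta_mx_mul (R : nzRingType) m n p (i : 'I_m) (j : 'I_n) (A : 'M[R]_(n, p)) :
  delta_mx i j *m A = \sum_k A j k *: delta_mx i k.
Proof.
apply/matrixP=> a b; rewrite summxE mxE (bigD1 j) //= (bigD1 b) //=.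
rewrite !big1 => [|k /negPf nk|k /negPf nk]; rewrite !mxE ?nk ?andbF ?mul0r //.
  by rewrite !eqxx !addr0 !andbT; case: (a == i); rewrite ?mulr1 ?mulr0 ?mul1r ?mul0r.
by rewrite (eq_sym b) nk andbF mulr0.
Qed.

(** * Density and the comparison of simple modules *)

Section Density.

Variables (F : closedFieldType) (gT : finGroupType) (G : {group gT}).
Variables (n1 n2 : nat).
Variables (rG1 : mx_representation F G n1) (rG2 : mx_representation F G n2).
Hypotheses (irr1 : mx_irreducible rG1) (irr2 : mx_irreducible rG2).
Local Notation R_G := (group_ring F G).

(** Burnside: over an algebraically closed field the matrices of a simple module span the full
    matrix algebra. *)
Lemma gring_op_onto n (rG : mx_representation F G n) (B : 'M_n) :
  mx_irreducible rG -> exists2 A, (A \in R_G)%MS & gring_op rG A = B.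
Proof.
move=> irr; have /mx_abs_irrP[_ [a aE]] := group_closure_closed_field irr.
exists (\sum_(x in G) a x B *: regular_repr F G x).
  by apply/envelop_mxP; exists (a^~ B).
rewrite [RHS]aE linear_sum; apply: eq_bigr => x Gx.
by rewrite linearZ /= gring_opG.
Qed.

(* An operator intertwining rG2 and rG1, built from a vector v of rG1: its row j
   is v times the image of the matrix unit E_(0, j). *)
Lemma mx_rsim_gring_ker :
  (forall A, (A \in R_G)%MS -> gring_op rG2 A = 0 -> gring_op rG1 A = 0) ->
  mx_rsim rG2 rG1.
Proof.
move=> kerS; have [n2_gt0 min2] := (mx_irrP rG2).1 irr2.
have [n1_gt0 min1] := (mx_irrP rG1).1 irr1.
pose i0 := Ordinal n2_gt0.
have lift i j : {A | (A \in R_G)%MS & gring_op rG2 A = delta_mx i j}.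
  by apply/sig2_eqW; exact: gring_op_onto.
pose E i j : 'M_#|G| := s2val (lift i j).
have RE i j : (E i j \in R_G)%MS by rewrite /E; case: (lift i j).
have opE i j : gring_op rG2 (E i j) = delta_mx i j by rewrite /E; case: (lift i j).
(* The sum of the products E_(i, 0) E_(0, i) is 1 on rG2, hence also on rG1 by [kerS]; so some E_(0,
   j) is nonzero on rG1. *)
have oneE : 1%:M = \sum_i gring_op rG1 (E i i0) *m gring_op rG1 (E i0 i).
  apply/eqP; rewrite -subr_eq0 -(gring_op1 rG1).
  under eq_bigr do rewrite -gring_opM //.
  rewrite -linear_sum -linearB; apply/eqP/kerS.
    rewrite linearB /= addmx_sub ?envelop_mx1 // eqmx_opp linear_sum.
    by apply: summx_sub => i _; apply: envelop_mxM.
  rewrite linearB linear_sum /= gring_op1; apply/eqP; rewrite subr_eq0 mx1_sum_delta.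
  apply/eqP/eq_bigr => i _; rewrite gring_opM // !opE mul_delta_mx //.
have [j nzj] : exists j, gring_op rG1 (E i0 j) != 0.
  apply/existsP; apply: contraPT oneE => /existsPn E0.
  rewrite big1 => [|i _]; last by rewrite (eqP (negbNE (E0 i))) mulmx0.
  by move/eqP; rewrite -mxrank_eq0 mxrank1 -leqn0 leqNgt n1_gt0.
have [k nzk] : exists k, row k (gring_op rG1 (E i0 j)) != 0.
  apply/existsP; apply: contraNT nzj => /existsPn r0.
  by apply/eqP/row_matrixP=> i; rewrite row0; apply/eqP/negbNE/r0.
pose P : 'M_(n2, n1) := \matrix_i row k (gring_op rG1 (E i0 i)).
have homP x : x \in G -> rG2 x *m P = P *m rG1 x.
  move=> Gx; apply/row_matrixP=> i; rewrite !row_mul rowK mulmx_sum_row -row_mul.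
  (* This expansion of E_(0, i) x holds on rG2 and is transported to rG1 by [kerS]. *)
  have -> : gring_op rG1 (E i0 i) *m rG1 x = \sum_j rG2 x i j *: gring_op rG1 (E i0 j).
    rewrite -(gring_opG rG1 Gx) -gring_opM ?envelop_mx_id //.
    under eq_bigr do rewrite -linearZ.
    apply/eqP; rewrite -subr_eq0 -linear_sum -linearB; apply/eqP/kerS.
      rewrite linearB /= addmx_sub ?envelop_mxM ?envelop_mx_id // eqmx_opp.
      rewrite linear_sum summx_sub // => j1 _; rewrite linearZ scalemx_sub //; exact: RE.
    rewrite linearB /= gring_opM ?envelop_mx_id // gring_opG // opE.
    apply/eqP; rewrite subr_eq0 delta_mx_mul; apply/eqP.
    by rewrite linear_sum; apply: eq_bigr => j' _; rewrite linearZ /= opE.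
  rewrite linear_sum; apply: eq_bigr => j' _.
  by rewrite rowK linearZ mxE.
have nzP : P != 0.
  apply: contraNneq nzk => P0.
  rewrite -[row k _](rowK (fun i => row k (gring_op rG1 (E i0 i)))).
  by rewrite -/P P0 row0.
have freeP : row_free P.
  (* Schur's lemma: the kernel and the image of [P] are submodules. *)
  rewrite -kermx_eq0; apply: contraNT nzP => nzK.
  have /row_fullP[B BK] : row_full (kermx P).
    apply: min2 => //; apply/mxmoduleP=> x Gx; apply/sub_kermxP.
    by rewrite -mulmxA homP // mulmxA mulmx_ker mul0mx.
  by rewrite -[P]mul1mx -BK -mulmxA mulmx_ker mulmx0.
have fullP : row_full P.
  rewrite /row_full -genmxE; apply: min1.
    rewrite (eqmx_module _ (genmxE P)); apply/mxmoduleP=> x Gx.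
    by rewrite -homP // submxMl.
  by rewrite (eqmx_eq0 (genmxE P)).
exists P => //.
by move/eqP: freeP => <-; apply/eqP.
Qed.

End Density.

(** * The block of a central character *)

(** A root of 1 + X + ... + X^(q-1) will do, since this polynomial takes the nonzero value q at
    1. *)
Lemma closed_field_prime_root (F : closedFieldType) q :
  prime q -> q%:R != 0 :> F -> exists2 w : F, w ^+ q = 1 & w != 1.
Proof.
move=> q_pr q0; pose P : {poly F} := \sum_(i < q) 'X^i.
have P1 : P.[1] = q%:R.
  rewrite /P horner_sum -[in RHS](card_ord q) -sum1_card natr_sum.
  by apply: eq_bigr => i _; rewrite hornerXn expr1n.
have EP : 'X^q - 1 = ('X - 1) * P by rewrite subrX1.
have : size P != 1%N.
  apply/eqP=> sP; have := size_polyMleq ('X - 1 : {poly F}) P.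
  rewrite -EP sP -[1]/(1%:P) size_XsubC size_XnsubC ?prime_gt0 // ltnS.
  by rewrite leqNgt prime_gt1.
case/closed_rootP=> w Pw; exists w.
  apply/eqP; rewrite -subr_eq0; have := congr1 (horner^~ w) EP.
  by rewrite !hornerE (eqP Pw) mulr0 => ->.
by apply: contraTneq Pw => ->; rewrite /root P1.
Qed.

Lemma mxtrace_delta (R : comNzRingType) n (i j : 'I_n) :
  \tr (delta_mx i j : 'M[R]_n) = (i == j)%:R.
Proof.
rewrite /mxtrace (bigD1 i) //= mxE eqxx big1 ?addr0 // => k /negPf nk.
by rewrite mxE nk.
Qed.

Lemma mxtrace_delta_mul (R : comNzRingType) n (A : 'M[R]_n) m (k : 'I_m) i j :
  \tr (delta_mx k i *m A *m delta_mx j k) = A i j.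
Proof.
rewrite mxtrace_mulC mulmxA mul_delta_mx delta_mx_mul linear_sum (bigD1 j) //=.
rewrite linearZ /= mxtrace_delta eqxx mulr1 big1 ?addr0 // => l /negPf nl.
by rewrite linearZ /= mxtrace_delta eq_sym nl mulr0.
Qed.

Section Existence.

Variables (F : closedFieldType) (gT : finGroupType) (G : {group gT}).
Local Notation aG := (regular_repr F G).

Lemma gring_op_submod (U : 'M_#|G|) (modU : mxmodule aG U) m (W : 'M_(m, \rank U)) A :
  (A \in group_ring F G)%MS ->
  val_submod (W *m gring_op (submod_repr modU) A) = val_submod W *m A.
Proof.
case/envelop_mxP=> a ->; rewrite !linear_sum /=.
apply: eq_bigr => x Gx.
by rewrite !linearZ /= gring_opG // val_submodJ.
Qed.

(** A simple submodule of the ideal generated by [f] is fixed pointwise by the idempotent [f]. *)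
Lemma irr_repr_idempotent (f : 'M_#|G|) :
  (f \in 'Z(group_ring F G))%MS -> f *m f = f -> f != 0 ->
  exists n (rG : mx_representation F G n), mx_irreducible rG /\ gring_op rG f = 1%:M.
Proof.
move=> /center_mxP[Rf cf] ff nzf.
have modf : mxmodule aG f.
  by apply/mxmoduleP=> x Gx; rewrite -cf ?envelop_mx_id // submxMl.
have [V simV sVf] := dec_mxsimple_exists modf nzf.
have [modV nzV _] := simV.
exists _, (submod_repr modV); split; first exact/submod_mx_irr.
apply: (can_inj (@val_submodK _ _ V _)); rewrite -[gring_op _ _]mul1mx gring_op_submod //.
have /submxP[B ->] : (val_submod (1%:M : 'M_(\rank V)) <= f)%MS.
  by apply: submx_trans sVf; apply: val_submodP.
by rewrite -mulmxA ff.
Qed.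

End Existence.

(** * Coefficients in the group algebra *)

Section Coefficients.

Variables (F : closedFieldType) (gT : finGroupType) (G : {group gT}).
Local Notation aG := (regular_repr F G).
Local Notation R_G := (group_ring F G).
Implicit Types (A B : 'M[F]_#|G|) (a : F).

Lemma gcoefD A B x : gcoef (A + B) x = gcoef A x + gcoef B x.
Proof. by rewrite /gcoef linearD mxE. Qed.

Lemma gcoefZ a A x : gcoef (a *: A) x = a * gcoef A x.
Proof. by rewrite /gcoef linearZ mxE. Qed.

Lemma gcoef_sum I (r : seq I) (P : pred I) (f : I -> 'M[F]_#|G|) x :
  gcoef (\sum_(i <- r | P i) f i) x = \sum_(i <- r | P i) gcoef (f i) x.
Proof. by rewrite /gcoef linear_sum summxE. Qed.

Lemma gcoef_repr x y : x \in G -> y \in G -> gcoef (aG y) x = (x == y)%:R.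
Proof.
move=> Gx Gy; have E (M : 'rV[F]_#|G|) i : row i M^T 0 0 = M 0 i by rewrite !mxE.
have /matrixP/(_ 0 0) := gring_projE F Gx Gy.
by rewrite /gring_proj /= E /gcoef => ->; case: (x == y); rewrite mxE.
Qed.

Lemma gcoefE A : (A \in R_G)%MS -> A = \sum_(x in G) gcoef A x *: aG x.
Proof.
case/envelop_mxP=> a ->; apply: eq_bigr => x Gx; congr (_ *: _).
rewrite gcoef_sum (bigD1 x) //= gcoefZ gcoef_repr // eqxx mulr1 big1 ?addr0 //.
by move=> y /andP[Gy nyx]; rewrite gcoefZ gcoef_repr // eq_sym (negPf nyx) mulr0.
Qed.

Lemma gring_op_rsim n1 n2 (rG1 : mx_representation F G n1)
    (rG2 : mx_representation F G n2) (B : 'M_(n1, n2)) (B' : 'M_(n2, n1)) A :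
  (forall x, x \in G -> rG1 x = B *m rG2 x *m B') -> (A \in R_G)%MS ->
  gring_op rG1 A = B *m gring_op rG2 A *m B'.
Proof.
move=> simB /envelop_mxP[a ->]; rewrite !linear_sum ?mulmx_sumr mulmx_suml /=.
apply: eq_bigr => x Gx; rewrite !linearZ /= !gring_opG // simB //.
by rewrite -?scalemxAr -scalemxAl.
Qed.

End Coefficients.

Section CentralIdempotent.

Variables (p q : nat) (F : closedFieldType) (gT : finGroupType) (G : {group gT}).
Variables (z : gT) (w : F).
Hypotheses (charF : p \in [pchar F]) (zC : z \in 'Z(G)%g) (oz : #[z]%g = q).
Hypotheses (q_pr : prime q) (neq_pq : p != q) (wX : w ^+ q = 1) (w_neq1 : w != 1).
Local Notation aG := (regular_repr F G).
Local Notation R_G := (group_ring F G).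

(** The idempotent of the linear character of [<[z]>] that sends [z] to [w]. *)
Definition zidem : 'M[F]_#|G| :=
  q%:R^-1 *: \sum_(i < q) w^-1 ^+ i *: aG (z ^+ i)%g.

Let Gz : z \in G. Proof. by case/setIP: zC. Qed.

Let p_pr : prime p := pcharf_prime charF.

Lemma q_neq0 : q%:R != 0 :> F.
Proof. by rewrite -(dvdn_pcharf charF) dvdn_prime2. Qed.

Let w_neq0 : w != 0.
Proof.
apply: contra_eq_neq wX => ->.
by rewrite expr0n -(prednK (prime_gt0 q_pr)) eq_sym oner_neq0.
Qed.

Lemma zidem_ring : (zidem \in R_G)%MS.
Proof.
rewrite linearZ scalemx_sub // linear_sum summx_sub // => i _.
by rewrite linearZ scalemx_sub // envelop_mx_id ?groupX.
Qed.

Lemma zidem_center : (zidem \in 'Z(R_G))%MS.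
Proof.
apply/center_mxP; split=> [|_ /envelop_mxP[a ->]]; first exact: zidem_ring.
rewrite mulmx_suml mulmx_sumr; apply: eq_bigr => x Gx.
rewrite -[(a x *: _) *m _]scalemxAl -[_ *m (a x *: _)]scalemxAr; congr (_ *: _).
rewrite /zidem -scalemxAl -scalemxAr mulmx_suml mulmx_sumr; congr (_ *: _).
apply: eq_bigr => i _; rewrite -scalemxAl -scalemxAr -!repr_mxM ?groupX //.
have [_ /centP cz] := setIP zC; congr (_ *: aG _).
exact/commuteX/commute_sym/cz.
Qed.

Lemma mul_z_zidem : aG z *m zidem = w *: zidem.
Proof.
rewrite /zidem -scalemxAr mulmx_sumr scalerA mulrC -scalerA; congr (_ *: _).
have zX : (z ^+ q = 1)%g by rewrite -oz expg_order.
pose f i := w^-1 ^+ i *: aG (z ^+ i)%g.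
have fE i : aG z *m f i = w *: f i.+1.
  rewrite -scalemxAr -repr_mxM ?groupX // -expgS scalerA.
  by rewrite exprS mulrA mulfV ?mul1r.
rewrite (eq_bigr (fun i : 'I_q => w *: f i.+1)) => [|i _]; last exact: fE.
rewrite -!scaler_sumr; congr (_ *: _).
(* The shifted sum differs only by its last term [f q], which equals [f 0] because w^q = 1 and z^q =
   1. *)
rewrite -!(big_mkord xpredT f) -(big_mkord xpredT (fun i => f i.+1)).
rewrite -(prednK (prime_gt0 q_pr)) big_nat_recr // big_nat_recl // addrC.
congr (_ + _); rewrite /f prednK ?prime_gt0 // exprVn wX zX.
by rewrite !expr0 invr1.
Qed.

Lemma gring_op_z n (rG : mx_representation F G n) :
  gring_op rG zidem = 1%:M -> rG z = w%:M.
Proof.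
move=> re; have := congr1 (gring_op rG) mul_z_zidem.
rewrite gring_opM ?zidem_ring // gring_opG // re mulmx1 => ->.
by rewrite [LHS]linearZ /= re scalemx1.
Qed.

Lemma zidem_idem : zidem *m zidem = zidem.
Proof.
rewrite {1}/zidem -scalemxAl mulmx_suml.
have zE i : aG (z ^+ i)%g *m zidem = w ^+ i *: zidem.
  elim: i => [|i IHi]; first by rewrite repr_mx1 mul1mx scale1r.
  rewrite expgSr repr_mxM ?groupX // -mulmxA mul_z_zidem -scalemxAr IHi.
  by rewrite scalerA -exprS.
rewrite (eq_bigr (fun _ => zidem)) => [|i _]; last first.
  by rewrite -scalemxAl zE scalerA exprVn mulVf ?scale1r // expf_neq0.
by rewrite sumr_const card_ord -scaler_nat scalerA mulVf ?scale1r // q_neq0.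
Qed.

(* tau x is the scalar of the p'-part of x if it lies in <z>, and 0
   otherwise. *)
Lemma mxtrace_central_type : central_type p G z ->
  exists tau : gT -> F, forall n (rG : mx_representation F G n),
    rG z = w%:M -> {in G, forall x, \tr (rG x) = n%:R * tau x}.
Proof.
move=> ctG.
pose tau x := if [pick i : 'I_q | z ^+ i == x.`_p^']%g is Some i then w ^+ i else 0.
exists tau => n rG rz x Gx; rewrite (mxtrace_p'constt charF) // /tau.
have rzX i : rG (z ^+ i)%g = (w ^+ i)%:M.
  elim: i => [|j IHj]; first by rewrite repr_mx1.
  by rewrite expgS repr_mxM ?groupX // IHj rz exprS scalar_mxM.
case: pickP => [i /eqP <- | noz]; first by rewrite rzX mxtrace_scalar mulr_natl.
have [||c Gc] := ctG x.`_p^'%g _ (p_elt_constt _ _).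
- by rewrite groupX.
- apply/negP=> /cyclePmin[i lt_i xE]; rewrite oz in lt_i.
  by have := noz (Ordinal lt_i); rewrite /= xE eqxx.
case/setD1P=> nt_c /cyclePmin[i lt_i cE]; rewrite oz in lt_i.
rewrite mulr0; apply: (@mxtrace_central _ _ _ _ _ (w ^+ i) _ c); rewrite ?groupX //.
  by rewrite cE rzX.
apply: contra nt_c => /eqP wi; rewrite cE.
(* Both [w] and [z] have order q, so w^i = 1 would force z^i = 1. *)
have w_prim : q.-primitive_root w.
  have [m wm] := prim_order_exists (prime_gt0 q_pr) wX.
  have /primeP[_ dvd_q] := q_pr; case/dvd_q/orP=> /eqP Em; last by rewrite -Em.
  by have := prim_expr_order wm; rewrite Em expr1 => /eqP; rewrite (negPf w_neq1).
by rewrite -order_dvdn oz (prim_order_dvd w_prim) wi.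
Qed.

(** On both modules the trace of any A is the dimension times one common scalar. If A kills rG2 but
    not rG1, matrix units isolate a nonzero entry of A on rG1 as a trace, whereas the trace on rG2
    is 0. *)
Lemma zidem_rsim n1 n2 (rG1 : mx_representation F G n1)
    (rG2 : mx_representation F G n2) :
  central_type p G z -> mx_irreducible rG1 -> mx_irreducible rG2 ->
  gring_op rG1 zidem = 1%:M -> gring_op rG2 zidem = 1%:M -> mx_rsim rG1 rG2.
Proof.
move=> ctG irr1 irr2 e1 e2; have [tau trE] := mxtrace_central_type ctG.
have trA A : (A \in R_G)%MS -> exists T, forall n (rG : mx_representation F G n),
    gring_op rG zidem = 1%:M -> \tr (gring_op rG A) = n%:R * T.
  case/envelop_mxP=> a ->; exists (\sum_(x in G) a x * tau x) => n rG re.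
  rewrite !linear_sum mulr_sumr; apply: eq_bigr => x Gx.
  rewrite linearZ linearZ /= gring_opG // (trE _ _ (gring_op_z re)) //.
  by rewrite mulrCA.
apply: mx_rsim_sym.
apply: (mx_rsim_gring_ker irr1 irr2) => A RA A2; apply/eqP.
have [n1_gt0 _] := (mx_irrP rG1).1 irr1; have [n2_gt0 _] := (mx_irrP rG2).1 irr2.
apply: contraT => nzA.
have /matrix0Pn[i [j nzij]] := nzA.
have [B RB Bi] := gring_op_onto (delta_mx (Ordinal n1_gt0) i) irr1.
have [C RC Cj] := gring_op_onto (delta_mx j (Ordinal n1_gt0)) irr1.
have [D RD D0] := gring_op_onto (delta_mx (Ordinal n2_gt0) (Ordinal n2_gt0)) irr2.
have RBAC : (B *m A *m C \in R_G)%MS by rewrite !envelop_mxM.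
have [T TE] := trA _ RBAC; have [U UE] := trA _ RD.
(* An element of trace 1 on rG2 shows that p does not divide [n2]. *)
have nz2 : n2%:R != 0 :> F.
  have := UE _ _ e2; rewrite D0 mxtrace_delta eqxx => E.
  by apply: contra_eq_neq E => ->; rewrite mul0r oner_neq0.
have /eqP := TE _ _ e2; rewrite !gring_opM // A2 mulmx0 mul0mx mxtrace0 eq_sym.
rewrite mulf_eq0 (negPf nz2) /= => /eqP T0.
have := TE _ _ e1; rewrite T0 mulr0 !gring_opM // Bi Cj mxtrace_delta_mul => /eqP.
by rewrite (negPf nzij).
Qed.

Lemma gcoef_zidem1 : gcoef zidem 1%g = q%:R^-1.
Proof.
rewrite gcoefZ gcoef_sum (bigD1 (Ordinal (prime_gt0 q_pr))) //= big1 => [|i nz_i].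
  by rewrite gcoefZ expr0 gcoef_repr ?group1 // eqxx addr0 !mulr1.
rewrite gcoefZ gcoef_repr ?groupX // eq_sym -order_dvdn oz gtnNdvd ?mulr0 //.
by rewrite lt0n; apply: contra nz_i => /eqP i0; apply/eqP/val_inj.
Qed.

Lemma zidem_neq0 : zidem != 0.
Proof.
apply: contra_eq_neq gcoef_zidem1 => ->.
by rewrite /gcoef linear0 mxE eq_sym invr_neq0 ?q_neq0.
Qed.

(** Were [f] and its complement both nonzero, each would act as 1 on some simple module of [zidem];
    these modules are isomorphic, yet [f] acts as 1 on one and as 0 on the other. *)
Lemma zidem_block : central_type p G z -> block zidem.
Proof.
move=> ctG; split=> [||| f Zf ff ef]; rewrite ?zidem_center ?zidem_idem ?zidem_neq0 //.
have [-> | nzf] := eqVneq f 0; [by left | right].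
apply/eqP; rewrite eq_sym -subr_eq0; apply: contraT => nz_ef.
have [Rf cf] := center_mxP Zf; have [Re ce] := center_mxP zidem_center.
have fe : f *m zidem = f by rewrite -cf.
have [|||n1 [rG1 [irr1 f1]]] := irr_repr_idempotent (f := f) => //.
have [|||n2 [rG2 [irr2 f2]]] := irr_repr_idempotent (f := zidem - f) => //.
- by rewrite linearB addmx_sub ?zidem_center // eqmx_opp.
- by rewrite mulmxBl !mulmxBr zidem_idem ef fe ff subrr subr0.
have e1 : gring_op rG1 zidem = 1%:M.
  by rewrite -[LHS]mul1mx -f1 -gring_opM // fe.
have e2 : gring_op rG2 zidem = 1%:M.
  by rewrite -[LHS]mul1mx -f2 -gring_opM // mulmxBl zidem_idem fe.
have f2_0 : gring_op rG2 f = 0.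
  apply/eqP; have /eqP := f2; rewrite linearB /= e2 subr_eq -{1}[1%:M]addr0.
  by rewrite (inj_eq (addrI _)) eq_sym.
have [B [B' _ simB]] := mx_rsim_def (zidem_rsim ctG irr1 irr2 e1 e2).
have /eqP := f1; rewrite (gring_op_rsim simB Rf) f2_0 mulmx0 mul0mx eq_sym.
by have [n1_gt0 _] := (mx_irrP rG1).1 irr1; rewrite -mxrank_eq0 mxrank1 gtn_eqF.
Qed.

(** Central elements act as scalars on a simple module; [lam] reads off a diagonal entry. *)
Lemma zidem_central_character : exists lam, central_character zidem lam.
Proof.
have [n [rG [irr e1]]] := irr_repr_idempotent zidem_center zidem_idem zidem_neq0.
have [n_gt0 _] := (mx_irrP rG).1 irr; pose i0 := Ordinal n_gt0.
have scal y : (y \in 'Z(R_G))%MS -> gring_op rG y = (gring_op rG y i0 i0)%:M.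
  case/center_mxP=> Ry cy.
  have /is_scalar_mxP[a ->] : is_scalar_mx (gring_op rG y).
    apply: mx_abs_irr_cent_scalar (group_closure_closed_field irr) _ _.
    apply/centgmxP=> x Gx; rewrite -(gring_opG rG Gx) -!gring_opM ?cy ?envelop_mx_id //.
  by rewrite mxE eqxx.
exists (fun y => gring_op rG y i0 i0); split.
- by move=> a y1 y2 _ _; rewrite linearP !mxE.
- move=> y1 y2 Z1 Z2; rewrite gring_opM; last by have [] := center_mxP Z2.
  by rewrite (scal _ Z1) (scal _ Z2) -scalar_mxM !mxE eqxx.
by rewrite e1 mxE eqxx.
Qed.

End CentralIdempotent.

(** * The Brauer homomorphism, defect and nilpotency *)

(** Outside the centraliser, Q-orbits have length divisible by p and contribute 0. *)
Lemma sum_pgroup_cent (R : nzRingType) p (gT : finGroupType) (G Q : {group gT})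
    (f : gT -> R) :
  p \in [pchar R] -> p.-group Q -> Q \subset G ->
  {in G & Q, forall x u, f (x ^ u)%g = f x} ->
  \sum_(x in G) f x = \sum_(x in 'C_G(Q)%g) f x.
Proof.
move=> charR pQ sQG fJ; rewrite (big_setID 'C(Q)%g) /=.
suff -> : \sum_(x in G :\: 'C(Q)%g) f x = 0 by rewrite addr0.
have actsQ : [acts Q, on G :\: 'C(Q) | 'J]%g.
  apply/subsetP=> u Qu; rewrite !inE; apply/subsetP=> x /setDP[Gx nCx].
  rewrite inE; apply/setDP; rewrite /=; split; first by rewrite groupJ // (subsetP sQG).
  rewrite -mem_conjgV (normP _) // groupV (subsetP (cent_norm _)) //.
  exact: (subsetP (normG Q)).
rewrite (set_partition_big _ (orbit_partition actsQ)) /=.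
apply: big1 => _ /imsetP[x /setDP[Gx nCx] ->].
rewrite (eq_bigr (fun _ => f x)) => [|_ /imsetP[u Qu ->]]; last exact: fJ.
rewrite sumr_const; apply/eqP.
have : (p %| #|orbit 'J%act Q x|)%N.
  have /p_natP[k ok] : p.-nat #|orbit 'J%act Q x|.
    by apply: pnat_dvd pQ; rewrite card_orbit dvdn_indexg.
  rewrite ok; case: k ok => [|k] ok; last by rewrite expnS dvdn_mulr.
  case/negP: nCx; apply/centP=> u Qu; apply/commgP/conjg_fixP.
  by have := mem_orbit 'J%act x Qu; rewrite (card_orbit1 ok) => /set1P.
by case/dvdnP=> k ->; rewrite mulnC mulrnA (mulrn_pchar charR) mul0rn.
Qed.

Section BrauerMap.

Variables (F : closedFieldType) (gT : finGroupType).
Local Notation aG G := (regular_repr F G).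
Local Notation R_ G := (group_ring F G).
Implicit Types G H : {group gT}.

Lemma gcoef_inj G (A B : 'M[F]_#|G|) : (A \in R_ G)%MS -> (B \in R_ G)%MS ->
  {in G, gcoef A =1 gcoef B} -> A = B.
Proof.
move=> RA RB eqAB; rewrite [A]gcoefE // [B]gcoefE //; apply: eq_bigr => x Gx.
by rewrite eqAB.
Qed.

Lemma gcoefMl G (A : 'M[F]_#|G|) g x : (A \in R_ G)%MS -> g \in G -> x \in G ->
  gcoef (aG G g *m A) x = gcoef A (g^-1 * x)%g.
Proof.
move=> /gcoefE {1}-> Gg Gx; rewrite mulmx_sumr gcoef_sum.
rewrite (bigD1 (g^-1 * x)%g) ?groupM ?groupV //=.
rewrite -scalemxAr gcoefZ -repr_mxM ?groupM ?groupV // mulKVg gcoef_repr // eqxx mulr1.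
rewrite big1 ?addr0 // => y /andP[Gy ny].
rewrite -scalemxAr gcoefZ -repr_mxM // gcoef_repr ?groupM //.
by rewrite -(inj_eq (mulgI g^-1%g)) mulKg eq_sym (negPf ny) mulr0.
Qed.

Lemma gcoefM G (A B : 'M[F]_#|G|) x : (A \in R_ G)%MS -> (B \in R_ G)%MS -> x \in G ->
  gcoef (A *m B) x = \sum_(u in G) gcoef A u * gcoef B (u^-1 * x)%g.
Proof.
move=> /gcoefE {1}-> RB Gx; rewrite mulmx_suml gcoef_sum; apply: eq_bigr => u Gu.
by rewrite -scalemxAl gcoefZ gcoefMl.
Qed.

Lemma gcoef_center G (A : 'M[F]_#|G|) : (A \in 'Z(R_ G))%MS ->
  {in G &, forall x g, gcoef A (x ^ g)%g = gcoef A x}.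
Proof.
case/center_mxP=> RA cA x g Gx Gg; rewrite /conjg -gcoefMl ?groupM //.
rewrite cA ?envelop_mx_id // gcoefM ?envelop_mx_id ?groupM //.
rewrite (bigD1 x) //= gcoef_repr ?groupM ?groupV // mulKg eqxx mulr1 big1 ?addr0 //.
move=> u /andP[Gu nu]; rewrite gcoef_repr ?groupM ?groupV //.
by rewrite -(inj_eq (mulgI u)) mulKVg (inj_eq (mulIg g)) eq_sym (negPf nu) mulr0.
Qed.

Lemma center_gcoef G (A : 'M[F]_#|G|) : (A \in R_ G)%MS ->
  {in G &, forall x g, gcoef A (x ^ g)%g = gcoef A x} -> (A \in 'Z(R_ G))%MS.
Proof.
move=> RA cA; apply/center_mxP; split=> // _ /envelop_mxP[b ->].
rewrite mulmx_suml mulmx_sumr; apply: eq_bigr => g Gg.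
rewrite -scalemxAl -scalemxAr; congr (_ *: _).
apply: gcoef_inj => [||x Gx]; rewrite ?envelop_mxM ?envelop_mx_id //.
rewrite gcoefMl // gcoefM ?envelop_mx_id //.
have Gxg : (x * g^-1)%g \in G by rewrite groupM ?groupV.
rewrite (bigD1 (x * g^-1)%g) //= gcoef_repr ?groupM ?groupV //.
rewrite invMg invgK mulgVK eqxx mulr1 big1 ?addr0.
  by rewrite -[LHS](cA _ g^-1%g) ?groupM ?groupV // conjgE invgK mulgA mulVKg.
move=> u /andP[Gu nu]; rewrite gcoef_repr ?groupM ?groupV //.
case: eqP => [E|]; last by rewrite mulr0.
by case/eqP: nu; rewrite -E invMg invgK mulKVg.
Qed.

Lemma gtrunc_ring G H (A : 'M[F]_#|G|) : (gtrunc H A \in R_ H)%MS.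
Proof. by apply/envelop_mxP; exists (gcoef A). Qed.

Lemma gcoef_trunc G H (A : 'M[F]_#|G|) x : x \in H ->
  gcoef (gtrunc H A) x = gcoef A x.
Proof.
move=> Hx; rewrite gcoef_sum (bigD1 x) //= gcoefZ gcoef_repr // eqxx mulr1.
rewrite big1 ?addr0 // => y /andP[Hy nyx].
by rewrite gcoefZ gcoef_repr // eq_sym (negPf nyx) mulr0.
Qed.

Lemma gtrunc_linear G H a (A B : 'M[F]_#|G|) :
  gtrunc H (a *: A + B) = a *: gtrunc H A + gtrunc H B.
Proof.
rewrite /gtrunc scaler_sumr -big_split; apply: eq_bigr => x Hx.
by rewrite gcoefD gcoefZ scalerDl scalerA.
Qed.

Section Brauer.

Variables (p : nat) (G Q : {group gT}).
Hypotheses (charF : p \in [pchar F]) (pQ : p.-group Q) (sQG : Q \subset G).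
Local Notation C := 'C_G(Q)%G.

Let CG x : x \in C -> x \in G. Proof. by case/setIP. Qed.

Lemma brauer_center (A : 'M[F]_#|G|) : (A \in 'Z(R_ G))%MS ->
  (gtrunc C A \in 'Z(R_ C))%MS.
Proof.
move=> ZA; apply: center_gcoef (gtrunc_ring _ _) _ => x g Cx Cg.
by rewrite !gcoef_trunc ?groupJ // (gcoef_center ZA) ?CG.
Qed.

(** For [x] centralised by [Q], the terms of the convolution giving the coefficient at [x] are
    Q-invariant, so only those in the centraliser survive. *)
Lemma brauer_mul (A B : 'M[F]_#|G|) :
  (A \in 'Z(R_ G))%MS -> (B \in 'Z(R_ G))%MS ->
  gtrunc C (A *m B) = gtrunc C A *m gtrunc C B.
Proof.
move=> ZA ZB; have [RA _] := center_mxP ZA; have [RB _] := center_mxP ZB.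
apply: gcoef_inj => [||x Cx]; rewrite ?envelop_mxM ?gtrunc_ring //.
rewrite gcoef_trunc // !gcoefM ?gtrunc_ring ?CG //.
rewrite (sum_pgroup_cent charF pQ sQG) /=.
  by apply: eq_bigr => u Cu; rewrite !gcoef_trunc ?groupM ?groupV.
move=> u v Gu Qv /=; have Gv := subsetP sQG v Qv.
have cxv : (x ^ v)%g = x.
  by case/setIP: Cx => _ /centP/(_ v Qv)/commgP/conjg_fixP.
rewrite (gcoef_center ZA) // -conjVg -{1}cxv -conjMg (gcoef_center ZB) //.
by rewrite groupM ?groupV //; apply: CG.
Qed.

Lemma central_character_brauer (B : 'M[F]_#|G|) lam :
  (B \in 'Z(R_ G))%MS -> central_character (gtrunc C B) lam ->
  central_character B (lam \o gtrunc C).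
Proof.
move=> ZB [lamD lamM lam1]; split=> //= [a y1 y2 Z1 Z2 | y1 y2 Z1 Z2].
  by rewrite gtrunc_linear lamD ?brauer_center.
by rewrite brauer_mul // lamM ?brauer_center.
Qed.

End Brauer.

End BrauerMap.

Section Block.

Variables (p q : nat) (F : closedFieldType) (gT : finGroupType) (G : {group gT}).
Variables (z : gT) (w : F).
Hypotheses (charF : p \in [pchar F]) (zC : z \in 'Z(G)%g) (oz : #[z]%g = q).
Hypotheses (q_pr : prime q) (neq_pq : p != q) (wX : w ^+ q = 1) (w_neq1 : w != 1).

Let Gz : z \in G. Proof. by case/setIP: zC. Qed.

Lemma zidem_maximal_defect : maximal_defect p (zidem q G z w).
Proof.
move=> D maxD; rewrite -max_pgroup_Sylow.
have nz_trunc (H : {group gT}) : gtrunc H (zidem q G z w) != 0.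
  apply: contra_eq_neq (gcoef_zidem1 w zC oz q_pr) => E.
  rewrite -(gcoef_trunc (H := H)) ?group1 // E /gcoef linear0 mxE eq_sym invr_neq0 //.
  exact: q_neq0 charF q_pr neq_pq.
apply/maxgroupP; case/maxgroupP: maxD => /andP[pD _] maxD; split=> // E pE sDE.
by apply: maxD => //; rewrite pE nz_trunc.
Qed.

Lemma gtrunc_zidem (H : {group gT}) : z \in H -> H \subset G ->
  gtrunc H (zidem q G z w) = zidem q H z w.
Proof.
move=> Hz sHG; rewrite [RHS]gcoefE.
  apply: eq_bigr => x Hx; congr (_ *: _).
  rewrite !gcoefZ !gcoef_sum; congr (_ * _); apply: eq_bigr => i _.
  by rewrite !gcoefZ !gcoef_repr ?groupX // (subsetP sHG).
rewrite linearZ scalemx_sub // linear_sum summx_sub // => i _.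
by rewrite linearZ scalemx_sub // envelop_mx_id ?groupX.
Qed.

Lemma gconj_zidem (H : {group gT}) x : z \in H -> commute z x ->
  gconj x (zidem q H z w) = zidem q H z w.
Proof.
move=> Hz czx; rewrite /gconj.
transitivity (\sum_(y in H) q%:R^-1 *: \sum_(i < q)
    (w^-1 ^+ i * (y == z ^+ i)%g%:R) *: regular_repr F H (y ^ x)%g).
  apply: eq_bigr => y Hy; rewrite gcoefZ gcoef_sum -scalerA scaler_suml.
  congr (_ *: _); apply: eq_bigr => i _.
  by rewrite gcoefZ gcoef_repr ?groupX.
rewrite -scaler_sumr exchange_big; congr (_ *: _); apply: eq_bigr => i _ /=.
rewrite (bigD1 (z ^+ i)%g) ?groupX //= eqxx mulr1 big1 ?addr0.
  congr (_ *: regular_repr F H _); apply/conjg_fixP/commgP.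
  exact/commute_sym/commuteX/commute_sym.
by move=> y /andP[_ /negPf->]; rewrite mulr0 scale0r.
Qed.

(** The same sum taken in C_G(Q) is a block there, [central_type] being vacuous, and corresponds to
    the block of [G] through the Brauer homomorphism. It is stable under [G], so nilpotency would
    make G/C_G(Q) a p-group and put [x] in C_G(Q). *)
Lemma zidem_not_nilpotent (Q : {group gT}) : Q <| G -> p.-group Q ->
  (forall x, x \in 'C_G(Q) -> p^'.-elt x -> x \in <[z]>)%g ->
  (exists2 x, x \in G & p^'.-elt x && (x \notin <[z]>))%g ->
  ~ nilpotent_block p (zidem q G z w).
Proof.
move=> nQG pQ centQ [x Gx /andP[px nzx]] nilB.
have sQG := normal_sub nQG; pose C := 'C_G(Q)%G.
have [_ /centP cz] := setIP zC.
have Cz : z \in C.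
  by rewrite inE Gz; apply/centP=> u Qu; apply: cz; apply: (subsetP sQG).
have zCC : z \in 'Z(C)%g.
  by rewrite inE Cz; apply/centP=> u /setIP[Gu _]; apply: cz.
have ctC : central_type p C z.
  by move=> y Cy py /negP[]; apply: centQ.
have subp : subpair p (zidem q G z w) (zidem q C z w).
  split; first by rewrite /psubgroup sQG.
    exact: (zidem_block charF zCC oz q_pr neq_pq wX w_neq1 ctC).
  have [lam lamP] := zidem_central_character charF zCC oz q_pr neq_pq wX.
  exists (lam \o gtrunc C), lam; split=> //.
  apply: (central_character_brauer charF pQ sQG).
    exact: zidem_center.
  by rewrite gtrunc_zidem // subsetIl.
have stabE : subpair_stab (zidem q C z w) = G.
  apply/setP=> y; rewrite inE inE; case Gy: (y \in G) => //=.
  rewrite (subsetP (normal_norm nQG)) ?Gy //= gconj_zidem ?eqxx //.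
  exact: cz.
have pN := nilB _ _ subp; rewrite stabE in pN.
have nCx : x \in 'N('C_G(Q))%g.
  have := subcent_norm G Q; move/subsetP; apply.
  by rewrite inE Gx (subsetP (normal_norm nQG)).
have px1 : coset 'C_G(Q) x = 1%g.
  have pcx := mem_p_elt pN (mem_quotient _ Gx).
  have p'cx : p^'.-elt (coset 'C_G(Q) x) := morph_p_elt (coset_morphism _) nCx px.
  apply/eqP; rewrite -order_eq1; apply/eqP.
  by apply: (pnat_1 pcx p'cx).
by move/negP: nzx; apply; apply: centQ (coset_idr nCx px1) px.
Qed.

End Block.

(** * Brauer characters *)

From mathcomp Require Import finmap boolp classical_sets cardinality.

(** * Reduction and lifting of roots of unity *)

Section Reduction.

Variables (p : nat) (F : closedFieldType) (r : p_modular p F).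

Lemma red0 : r 0 = 0.
Proof.
by apply: (addrI (r 0)); rewrite -(redD r) ?rpred0 // !addr0.
Qed.

Lemma red_sum k (f : nat -> algC) : (forall i, f i \in Aint) ->
  r (\sum_(i < k) f i) = \sum_(i < k) r (f i).
Proof.
move=> Af; elim: k => [|k IHk]; first by rewrite !big_ord0 red0.
by rewrite !big_ord_recr /= -IHk (redD r) ?rpred_sum.
Qed.

Lemma redX a k : a \in Aint -> r (a ^+ k) = r a ^+ k.
Proof.
move=> Aa; elim: k => [|k IHk]; first by rewrite !expr0 (red1 r).
by rewrite !exprS (redM r) ?rpredX // IHk.
Qed.

Lemma coprime_natf_neq0 k : coprime p k -> k%:R != 0 :> F.
Proof.
move=> co_pk; rewrite -(dvdn_pcharf (pchar_red r)) -prime_coprime //.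
exact: pcharf_prime (pchar_red r).
Qed.

Lemma coprime_gt0 k : coprime p k -> (0 < k)%N.
Proof.
case: k => // /coprime_natf_neq0; by rewrite eqxx.
Qed.

(** Otherwise 1 + a + ... + a^(k-1) = 0, whose reduction is k, nonzero in [F]. *)
Lemma red_eq1 a k : coprime p k -> a ^+ k = 1 -> r a = 1 -> a = 1.
Proof.
move=> co_pk ak ra; have k_gt0 := coprime_gt0 co_pk.
have Aa : a \in Aint by apply/(Aint_unity_root k_gt0)/unity_rootP.
apply/eqP; apply: contraT => a1; case/eqP: (coprime_natf_neq0 co_pk).
have S0 : \sum_(i < k) a ^+ i = 0.
  apply: (mulfI (_ : a - 1 != 0)); first by rewrite subr_eq0.
  by rewrite -subrX1 ak subrr mulr0.
have := congr1 r S0; rewrite red0 red_sum => [|i]; last exact: rpredX.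
rewrite (eq_bigr (fun _ => 1)) => [|i _]; last by rewrite redX // ra expr1n.
by rewrite sumr_const card_ord.
Qed.

Lemma red_prim_root k : coprime p k ->
  exists2 a, k.-primitive_root a & k.-primitive_root (r a).
Proof.
move=> co_pk; have k_gt0 := coprime_gt0 co_pk.
have [a prim_a] := C_prim_root_exists k_gt0; exists a => //.
have Aa := Aint_prim_root prim_a; have ak := prim_expr_order prim_a.
have rak : r a ^+ k = 1 by rewrite -redX // ak (red1 r).
have [m prim_m dvd_m] := prim_order_exists k_gt0 rak.
suff : a ^+ m = 1.
  move/eqP; rewrite -(prim_order_dvd prim_a) => dvd_k.
  by rewrite (_ : k = m) //; apply/eqP; rewrite eqn_dvd dvd_k.
apply: (red_eq1 co_pk); first by rewrite exprAC ak expr1n.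
by rewrite redX // (prim_expr_order prim_m).
Qed.

Lemma red_lift k b : coprime p k -> b ^+ k = 1 -> exists2 a, a ^+ k = 1 & r a = b.
Proof.
move=> co_pk bk; have [a prim_a prim_ra] := red_prim_root co_pk.
have [i ->] := prim_rootP prim_ra bk; exists (a ^+ i).
  by rewrite exprAC (prim_expr_order prim_a) expr1n.
by rewrite redX ?(Aint_prim_root prim_a).
Qed.

Lemma red_inj k : coprime p k -> {in [pred a | a ^+ k == 1] &, injective r}.
Proof.
move=> co_pk a b /eqP ak /eqP bk; have [c prim_c prim_rc] := red_prim_root co_pk.
have [i ->] := prim_rootP prim_c ak; have [j ->] := prim_rootP prim_c bk.
rewrite !redX ?(Aint_prim_root prim_c) // => /eqP.
by rewrite (eq_prim_root_expr prim_rc) -(eq_prim_root_expr prim_c) => /eqP.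
Qed.

Lemma common_root_exponent (s : seq algC) : {in s, forall a, p'root_of_unity p a} ->
  exists2 k, coprime p k & {in s, forall a, a ^+ k = 1}.
Proof.
elim: s => [|a s IHs] ps; first by exists 1%N; rewrite ?coprimen1.
have [k co_k ka] := ps a (mem_head a s).
have [b sb|m co_m sm] := IHs; first by apply: ps; rewrite inE sb orbT.
exists (k * m)%N; first by rewrite coprimeMr co_k.
move=> b; rewrite inE => /predU1P[->|sb]; rewrite exprM ?ka ?expr1n //.
by rewrite exprAC sm ?expr1n.
Qed.

Lemma perm_map_inj_in (T1 T2 : eqType) (f : T1 -> T2) (P : pred T1) s t :
  {in P &, injective f} -> {subset s <= P} -> {subset t <= P} ->
  perm_eq (map f s) (map f t) -> perm_eq s t.
Proof.
move=> inj_f sP tP /seq.permP Est; apply/allP=> a; rewrite mem_cat => sta.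
have Pa : a \in P by case/orP: sta => [/sP|/tP].
have cE u : {subset u <= P} -> count (pred1 (f a)) (map f u) = count_mem a u.
  move=> uP; rewrite count_map; apply: eq_in_count => b /uP Pb /=.
  by apply/eqP/eqP => [/inj_f-> //|->].
by rewrite /= -(cE s) // -(cE t) // Est.
Qed.

(** All roots involved share an exponent prime to p, on whose roots reduction is injective; so the
    characteristic polynomial determines the multiset of lifts. *)
Lemma red_sum_inj (s t : seq algC) :
  {in s, forall a, p'root_of_unity p a} -> {in t, forall a, p'root_of_unity p a} ->
  \prod_(a <- s) ('X - (r a)%:P) = \prod_(a <- t) ('X - (r a)%:P) ->
  \sum_(a <- s) a = \sum_(a <- t) a.
Proof.
move=> ps pt Est; apply: perm_big.
have [a|k co_k k1] := @common_root_exponent (s ++ t).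
  by rewrite mem_cat => /orP[/ps|/pt].
apply: (perm_map_inj_in (red_inj co_k)) => [a sa|a ta|].
- by rewrite inE k1 // mem_cat sa.
- by rewrite inE k1 // mem_cat ta orbT.
by apply: prod_XsubC_eq; rewrite !big_map.
Qed.

End Reduction.

Section BrauerChar.

Variables (p : nat) (F : closedFieldType) (r : p_modular p F).
Variables (gT : finGroupType) (G : {group gT}).

Lemma char_poly_rsim n1 n2 (rG1 : mx_representation F G n1)
    (rG2 : mx_representation F G n2) x :
  mx_rsim rG1 rG2 -> x \in G -> char_poly (rG1 x) = char_poly (rG2 x).
Proof.
case=> B def_n; move: B; case: n2 / def_n rG2 => rG2 B.
rewrite row_free_unit => uB simB Gx; pose Bp := map_mx polyC B.
apply: (@mulIf _ (\det Bp)).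
  by rewrite det_map_mx polyC_eq0 -unitfE.
rewrite -det_mulmx [RHS]mulrC -det_mulmx; congr (\det _).
rewrite /char_poly_mx mulmxBl mulmxBr scalar_mxC; congr (_ - _).
by rewrite -!map_mxM simB.
Qed.

(** At a p-regular x the eigenvalues are roots of unity of exponent [#[x]], prime to p, hence lift;
    the values are then collected by choice. *)
Lemma affords_brauer_exists n (rG : mx_representation F G n) :
  exists phi, affords_brauer r rG phi.
Proof.
have ex x : exists a : algC, if (x \in G) && p^'.-elt x then
    exists s, [/\ {in s, forall a, p'root_of_unity p a},
      char_poly (rG x) = \prod_(a <- s) ('X - (r a)%:P) & a = \sum_(a <- s) a]
  else a = 0.
  case xG: ((x \in G) && _); last by exists 0.
  have [Gx px] := andP xG.
  have co_px : coprime p #[x].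
    rewrite prime_coprime ?(pcharf_prime (pchar_red r)) // -p'natE //.
    exact: pcharf_prime (pchar_red r).
  have [t Et] := closed_field_poly_normal (char_poly (rG x)).
  move: Et; rewrite (monicP (char_poly_monic _)) scale1r => Et.
  have tX : {in t, forall b, b ^+ #[x]%g = 1}.
    move=> b tb; have : eigenvalue (rG x) b.
      by rewrite eigenvalue_root_char Et root_prod_XsubC.
    case/eigenvalueP=> v vx nz_v.
    have vX i : v *m rG (x ^+ i)%g = b ^+ i *: v.
      elim: i => [|i IHi]; first by rewrite repr_mx1 mulmx1 scale1r.
      by rewrite expgS repr_mxM ?groupX // mulmxA vx -scalemxAl IHi scalerA exprS.
    have /eqP := vX #[x]%g; rewrite expg_order repr_mx1 mulmx1 -subr_eq0.
    rewrite -{1}[v]scale1r -scalerBl scaler_eq0 (negPf nz_v) orbF subr_eq0.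
    by move/eqP.
  have [s ps st] : exists2 s, {in s, forall a, p'root_of_unity p a} & map r s = t.
    elim: t tX {Et} => [|b t IHt] tX; first by exists [::].
    have [c tc|s ps <-] := IHt; first by apply: tX; rewrite inE tc orbT.
    have [a ak <-] := red_lift r co_px (tX b (mem_head b t)).
    exists (a :: s) => // c; rewrite inE => /predU1P[->|/ps //].
    by exists #[x]%g.
  exists (\sum_(a <- s) a), s; split=> //.
  by rewrite Et -st big_map.
have [phi phiP] := choice ex; exists [ffun x => phi x]; split=> [x Gx px | x nx].
  by have := phiP x; rewrite Gx px ffunE.
by have := phiP x; rewrite (negPf nx) ffunE.
Qed.

Lemma affords_brauer_rsim n1 n2 (rG1 : mx_representation F G n1)
    (rG2 : mx_representation F G n2) phi1 phi2 :
  mx_rsim rG1 rG2 -> affords_brauer r rG1 phi1 -> affords_brauer r rG2 phi2 ->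
  phi1 = phi2.
Proof.
move=> sim [phi1E phi1_0] [phi2E phi2_0]; apply/ffunP=> x.
have [/andP[Gx px]|nx] := boolP ((x \in G) && p^'.-elt x); last first.
  by rewrite phi1_0 ?phi2_0.
have [s [ps cs ->]] := phi1E x Gx px; have [t [pt ct ->]] := phi2E x Gx px.
by apply: (red_sum_inj (r := r) ps pt); rewrite -cs -ct; apply: char_poly_rsim.
Qed.

Lemma l_block1 (B : 'M[F]_#|G|) :
  (exists n (rG : mx_representation F G n), mx_irreducible rG /\ gring_op rG B = 1%:M) ->
  (forall n1 n2 (rG1 : mx_representation F G n1) (rG2 : mx_representation F G n2),
     mx_irreducible rG1 -> mx_irreducible rG2 ->
     gring_op rG1 B = 1%:M -> gring_op rG2 B = 1%:M -> mx_rsim rG1 rG2) ->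
  l_block r B = 1%N.
Proof.
move=> [n [rG [irr rB]]] uniq; have [phi phiP] := affords_brauer_exists rG.
suff E : IBr r B = [set phi]%classic by rewrite /l_block E fset_set1 cardfs1.
apply/seteqP; split=> [psi [n' [rG' [irr' rB' psiP]]] | _ ->].
  exact: affords_brauer_rsim (uniq _ _ _ _ irr' irr rB' rB) psiP phiP.
by exists n, rG; split.
Qed.

End BrauerChar.

Local Close Scope ring_scope.

Theorem theorem3 (p l : nat) (p_pr : prime p) (l_ge1 : (1 <= l)%N) :
  exists (gT : finGroupType) (G : {group gT}),
    [/\ solvable G, (l <= p_length p G)%N
      & forall (F : closedFieldType) (r : p_modular p F),
          exists B : 'M[F]_#|pred_of_set (gval G)|,
            [/\ block B, ~ nilpotent_block p B, maximal_defect p B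
              & l_block r B = 1%N]].
Proof.
have [q q_pr neq_pq] := prime_neq p.
(* One more step on top of the tower yields [x] and [Q]; term 2l+3 is then proper, hence so is term
   2l. *)
have [gT [z zt]] := tower_exists l p_pr q_pr neq_pq.
have [hT [u [[solH uC ou ctH ntH] [x px nx] [Q [nQ pQ cQ]]]]] :=
  tower_step p_pr q_pr neq_pq zt.
exists hT, [set: hT]%G; split=> // [|F r].
  apply: p_length_ge solH _; apply: upper_p_series_le ntH.
  by rewrite -addn3 leq_addr.
have charF := pchar_red r.
have q0 : (q%:R != 0 :> F)%R := q_neq0 charF q_pr neq_pq.
have [w wX w1] := closed_field_prime_root q_pr q0.
exists (zidem q [set: hT]%G u w); split.
- exact: zidem_block charF uC ou q_pr neq_pq wX w1 ctH.
- apply: (zidem_not_nilpotent charF uC ou q_pr neq_pq wX w1 nQ pQ).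
    by move=> y /setIP[_ cy] py; apply: cQ.
  by exists x; rewrite ?inE ?px.
- exact: zidem_maximal_defect charF uC ou q_pr neq_pq.
apply: l_block1.
  apply: irr_repr_idempotent; first exact: zidem_center.
    exact: zidem_idem charF uC ou q_pr neq_pq wX.
  exact: zidem_neq0 charF uC ou q_pr neq_pq.
move=> n1 n2 rG1 rG2 irr1 irr2 e1 e2.
exact: (zidem_rsim charF uC ou q_pr wX w1 ctH irr1 irr2 e1 e2).
Qed.
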